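(* Let $G/K$ be a symmetric space of noncompact type and of maximal rank, with $K$ connected, Cartan decomposition $\mathfrak{g}=\mathfrak{k}+\mathfrak{p}$ and rank $r$. Let $f_1,\ldots,f_r$ be algebraically independent homogeneous generators of $\mathbf{C}[\mathfrak{p}^c]^{K^c}$, let $\mathfrak{b}$ be a Borel subalgebra of $\mathfrak{k}^c$, and let $\Phi^c:\Lambda^r(\mathfrak{p}^c)\to\mathbf{C}[\mathfrak{p}^c]_m$ be the equivariant map defined in the context, where $m=\dim\mathfrak{k}$. Let $\mathfrak{v}$ be an $r$-dimensional $\mathfrak{b}$-stable complex subspace of $\mathfrak{p}^c$ such that for some $y\in\mathfrak{p}^c$ the set of restricted linear forms $\{(df_1)_y|_{\mathfrak{v}},\ldots,(df_r)_y|_{\mathfrak{v}}\}$ is linearly independent. Then $[\Lambda^r\mathfrak{v}]$ is the highest weight vector of an irreducible ($\mathfrak{k}^c$-)component of $\Lambda^r(\mathfrak{p}^c)$ which is not mapped to zero under $\Phi^c$.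
   Context: $\mathfrak{g}=\mathfrak{k}+\mathfrak{p}$ is the decomposition of the Lie algebra of $G$ into the $\pm1$-eigenspaces of the Cartan involution; $K$ acts on $\mathfrak{p}$ by the adjoint action (the isotropy representation of $G/K$). The inner product on $\mathfrak{p}$ is the restriction of the Cartan-Killing form of $\mathfrak{g}$, and that on $\mathfrak{k}$ is the negative of its restriction. The rank $r$ is the dimension of a maximal Abelian subspace of $\mathfrak{p}$; maximal rank means $\mathrm{rank}(G/K)=\mathrm{rank}(G)$, equivalently all restricted roots have multiplicity $1$ and the centralizer in $\mathfrak{k}$ of a maximal Abelian subspace of $\mathfrak{p}$ is zero. Then principal $K$-orbits in $\mathfrak{p}$ have dimension $m=\dim\mathfrak{k}$, and $m+r=d:=\dim\mathfrak{p}$. The superscript $c$ denotes complexification; the algebra $\mathbf{C}[\mathfrak{p}^c]^{K^c}$ of $K^c$-invariant complex polynomials on $\mathfrak{p}^c$ is a free polynomial algebra on $r$ homogeneous generators (Chevalley). Fix an orthonormal basis $x_1,\ldots,x_m$ of $\mathfrak{k}$ and an orientation of $\mathfrak{p}$, and let $*:\Lambda^r\mathfrak{p}\to\Lambda^m\mathfrak{p}$ be the Hodge star isomorphism (which is $K$-equivariant). Define $\Phi:\Lambda^r\mathfrak{p}\to\mathbf{R}[\mathfrak{p}]_m$ (homogeneous real polynomials of degree $m$ on $\mathfrak{p}$) by $$\Phi(\eta)(v)=\langle [x_1,v]\wedge\cdots\wedge[x_m,v],\,*\eta\rangle,\qquad \eta\in\Lambda^r\mathfrak{p},\ v\in\mathfrak{p}.$$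 $\Phi^c:\Lambda^r(\mathfrak{p}^c)\to\mathbf{C}[\mathfrak{p}^c]_m$ is its complexification (the complex-linear extension, with polynomials extended to $\mathfrak{p}^c$). The Borel subalgebra is of the form $\mathfrak{b}=\mathfrak{t}^c+\sum_{\alpha\in\Delta^+}(\mathfrak{k}^c)_\alpha$, where $\mathfrak{t}$ is the Lie algebra of a maximal torus of $K$ and $\Delta^+$ is a system of positive roots of $\mathfrak{k}^c$ with respect to $\mathfrak{t}^c$; highest weight vectors are taken with respect to $\mathfrak{b}$. For an $r$-dimensional subspace $\mathfrak{v}\subset\mathfrak{p}^c$, $[\Lambda^r\mathfrak{v}]$ denotes the decomposable element $u_1\wedge\cdots\wedge u_r\in\Lambda^r(\mathfrak{p}^c)$ for a basis $u_1,\ldots,u_r$ of $\mathfrak{v}$ (well defined up to a nonzero scalar). *)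

(* Defs.v *)
From HB Require Import structures.
From mathcomp Require Import all_boot all_order all_algebra.
From mathcomp Require Import reals topology normedtype sequences.
From mathcomp Require Import complex.
(* The notations of mpoly clash with those of topology. *)
From mathcomp Require Import -(notations) mpoly.

Set Implicit Arguments.
Unset Strict Implicit.
Unset Printing Implicit Defensive.

Import Order.TTheory GRing.Theory Num.Theory numFieldNormedType.Exports.
Local Open Scope ring_scope.
Local Open Scope complex_scope.
Local Open Scope classical_set_scope.

Structure lieAlgebra (F : fieldType) := LieAlgebra {
  lie_space :> vectType F;
  bracket : lie_space -> lie_space -> lie_space;
  bracket_linearl : forall y, linear (fun x => bracket x y);
  bracket_linearr : forall x, linear (bracket x);
  bracket_alt : forall x, bracket x x = 0;
  bracket_jacobi : forall x y z,
    bracket x (bracket y z) + bracket y (bracket z x)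
      + bracket z (bracket x y) = 0
}.

Arguments bracket {F l} x y.

Section LieAlgebras.
Context (F : fieldType) (g : lieAlgebra F).
Implicit Types (x y : g) (h s I : {vspace g}).

Definition killing x y : F :=
  let b := vbasis {:g} in
  \sum_i coord b i (bracket x (bracket y (tnth b i))).

Definition ideal I := forall x y, y \in I -> bracket x y \in I.

Definition abelian_sub h := forall x y, x \in h -> y \in h -> bracket x y = 0.

Definition maximal_abelian_in s h :=
  [/\ (h <= s)%VS, abelian_sub h
    & forall h', (h' <= s)%VS -> abelian_sub h' -> (h <= h')%VS -> h' = h].

(* Some term of the lower central series of h vanishes; the n-th term is
   spanned by the iterated brackets [x1, [x2, ..., [xn, y]]]. *)
Definition nilpotent_sub h :=
  exists n, forall (xs : seq g) y, size xs = n ->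
    {subset xs <= h} -> y \in h -> foldr bracket y xs = 0.

Definition cartan_subalgebra h :=
  [/\ forall x y, x \in h -> y \in h -> bracket x y \in h,
      nilpotent_sub h
    & forall x, (forall y, y \in h -> bracket x y \in h) -> x \in h].

Definition common_dim (P : {vspace g} -> Prop) (n : nat) :=
  (exists h, P h) /\ forall h, P h -> \dim h = n.

Definition lie_rank (n : nat) := common_dim cartan_subalgebra n.

(* Matrix, acting on row vectors of coordinates in the family b, of the
   restriction of ad x to the span of b. *)
Definition ad_mx n (b : n.-tuple g) x : 'M[F]_n :=
  \matrix_(i, j) coord b j (bracket x (tnth b i)).

End LieAlgebras.

Section SymmetricSpaces.
Context (R : realType) (g : lieAlgebra R) (theta : 'End(g)).

Definition cartan_involution :=
  [/\ forall x y : g, theta (bracket x y) = bracket (theta x) (theta y),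
      forall x, theta (theta x) = x
    & forall x, x != 0 -> 0 < - killing x (theta x)].

Definition kpart : {vspace g} := passmx.leigenspace theta 1.
Definition ppart : {vspace g} := passmx.leigenspace theta (-1).

(* Positive definiteness in cartan_involution makes g semisimple; the second
   clause excludes compact factors. *)
Definition noncompact_type :=
  cartan_involution /\
  forall I : {vspace g}, ideal I -> (I <= kpart)%VS -> I = 0%VS.

Definition symmetric_rank (n : nat) :=
  common_dim (maximal_abelian_in ppart) n.

Definition maximal_rank := exists n, symmetric_rank n /\ lie_rank g n.

Definition orthonormal_basis_k m (x : m.-tuple g) :=
  basis_of kpart x /\
  forall i j, - killing (tnth x i) (tnth x j) = (i == j)%:R.

Definition orthonormal_basis_p d (e : d.-tuple g) :=
  basis_of ppart e /\
  forall i j, killing (tnth e i) (tnth e j) = (i == j)%:R.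

End SymmetricSpaces.

(* The exterior algebra of A^d: a S is the coordinate of a on
   e_{i_1} /\ ... /\ e_{i_k}, where i_1 < ... < i_k are the elements of S. *)
Definition ext (A : comNzRingType) (d : nat) := {ffun {set 'I_d} -> A^o}.

Section Exterior.
Context (A : comNzRingType) (d : nat).
Implicit Types (S T : {set 'I_d}) (a b : ext A d) (u : 'rV[A]_d).

Definition inversions S T : nat :=
  #|[set p : 'I_d * 'I_d | [&& p.1 \in S, p.2 \in T & (p.2 < p.1)%N]]%SET|.

Definition ext_mul a b : ext A d :=
  [ffun T : {set 'I_d} => \sum_(S : {set 'I_d} | S \subset T)
     (-1) ^+ inversions S (T :\: S) * (a S : A) * (b (T :\: S) : A)].

Definition ext_one : ext A d := [ffun S : {set 'I_d} => (S == finset.set0)%:R].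

Definition ext_vec u : ext A d :=
  [ffun S : {set 'I_d} => \sum_(j | S == [set j]%SET) u 0 j].

Definition wedge (us : seq 'rV[A]_d) : ext A d :=
  foldr (fun u a => ext_mul (ext_vec u) a) ext_one us.

Definition ext_dot a b : A := \sum_(S : {set 'I_d}) (a S : A) * (b S : A).

(* Hodge star for which e_1, ..., e_d is orthonormal and positively oriented:
   if a is the basis vector e_T, then a /\ (hodge a) = e_1 /\ ... /\ e_d. *)
Definition hodge a : ext A d :=
  [ffun S : {set 'I_d} => (-1) ^+ inversions (~: S)%SET S * (a (~: S)%SET : A)].

Definition ext_degree (k : nat) a := forall S, a S != 0 -> #|S| = k.

(* The derivation of the exterior algebra extending u |-> u *m M. *)
Definition ext_act (M : 'M[A]_d) a : ext A d :=
  \sum_(S : {set 'I_d}) (a S : A) *: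
    \sum_(i in S) wedge [seq if j == i then delta_mx 0 j *m M
                             else delta_mx 0 j | j <- enum S].

End Exterior.

Definition ext_map (A B : comNzRingType) d (h : A -> B) (a : ext A d) : ext B d :=
  [ffun S => h (a S)].

Lemma ext_map_wedge (A B : comNzRingType) d (h : {rmorphism A -> B})
    (us : seq 'rV[A]_d) :
  ext_map h (wedge us) = wedge [seq map_mx h u | u <- us].
Proof.
elim: us => [|u us IH] /=.
  by apply/ffunP=> S; rewrite !ffunE rmorph_nat.
rewrite -IH; apply/ffunP=> S; rewrite !ffunE rmorph_sum; apply: eq_bigr => T _.
rewrite !rmorphM rmorphXn rmorphN1 !ffunE rmorph_sum.
by congr (_ * _ * _); apply: eq_bigr => j _; rewrite mxE.
Qed.

Section Complexification.
Context (R : realType) (g : lieAlgebra R).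
Context (m d : nat) (x : m.-tuple g) (e : d.-tuple g).
Local Notation C := R[i].

(* With x a basis of k and e a basis of p, the complexifications k^c and p^c
   are 'rV[C]_m and 'rV[C]_d, by coordinates in x and in e.  For z in k^c,
   adc z b is ad z on the complex span of b (b = x or b = e). *)
Definition adc n (b : n.-tuple g) (z : 'rV[C]_m) : 'M[C]_n :=
  \sum_(i < m) z 0 i *: map_mx (real_complex R) (ad_mx b (tnth x i)).

Definition cbracket (z w : 'rV[C]_m) : 'rV[C]_m := w *m adc x z.
Definition cact (z : 'rV[C]_m) (u : 'rV[C]_d) : 'rV[C]_d := u *m adc e z.

Definition cvec (y : g) : 'rV[C]_m := \row_j (coord x j y)%:C.

Definition csub (t : {vspace g}) : {vspace 'rV[C]_m} :=
  <<[seq cvec y | y <- vbasis t]>>%VS.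

Definition exp_sum n (M : 'M[C]_n) (N : nat) : 'M[C]_n :=
  \sum_(k < N) (k`!%:R)^-1 *: M ^+ k.

Definition is_expmx n (M E : 'M[C]_n) :=
  forall i j, (fun N => exp_sum M N i j : C^o) @ \oo --> (E i j : C^o).

(* The image of K^c in GL(p^c): as K^c is connected, it is generated by
   exponentials of elements of k^c. *)
Inductive AdKc : 'M[C]_d -> Prop :=
| AdKc1 : AdKc 1%:M
| AdKcM z E M : is_expmx (adc e z) E -> AdKc M -> AdKc (E *m M).

Definition peval (f : mpoly d C) (u : 'rV[C]_d) : C := meval (fun j => u 0 j) f.

Definition Kc_invariant (f : mpoly d C) :=
  forall M u, AdKc M -> peval f (u *m M) = peval f u.

Definition free_homogeneous_generators r (f : r.-tuple (mpoly d C)) :=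
  [/\ forall i, tnth f i \is ishomog mdeg,
      forall q : mpoly r C, comp_mpoly f q = 0 -> q = 0
    & forall h : mpoly d C,
        Kc_invariant h <-> exists q : mpoly r C, h = comp_mpoly f q].

Definition differential (f : mpoly d C) (y u : 'rV[C]_d) : C :=
  \sum_(j < d) peval (mderiv j f) y * u 0 j.

Definition differentials_independent r (f : r.-tuple (mpoly d C))
    (v : {vspace 'rV[C]_d}) (y : 'rV[C]_d) :=
  forall c : 'I_r -> C,
    (forall u, u \in v -> \sum_i c i * differential (tnth f i) y u = 0) ->
    forall i, c i = 0.

(* The polynomial Phi(eta) is the pairing evaluated at the generic point of p,
   whose coordinates are the indeterminates. *)
Definition Phi (eta : ext R d) : mpoly d R :=
  let X : 'rV[mpoly d R]_d := \row_j mpolyX R (mnm1 j) in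
  ext_dot
    (wedge [seq X *m map_mx (@mpolyC d R) (ad_mx e xi) | xi <- x])
    (ext_map (@mpolyC d R) (hodge eta)).

Lemma Phi_eval (eta : ext R d) (v : 'rV[R]_d) :
  meval (fun j => v 0 j) (Phi eta) =
  ext_dot (wedge [seq v *m ad_mx e xi | xi <- x]) (hodge eta).
Proof.
rewrite /Phi /ext_dot rmorph_sum; apply: eq_bigr => S _ /=.
rewrite rmorphM /= ffunE mevalC; congr (_ * _).
have := congr1 (fun a : ext R d => a S)
  (ext_map_wedge (meval (fun j => v 0 j) : {rmorphism _ -> _})
   [seq (\row_j mpolyX R (mnm1 j)) *m map_mx (@mpolyC d R) (ad_mx e xi) | xi <- x]).
rewrite ffunE /= => ->; congr ((wedge _) S).
rewrite -map_comp; apply: eq_map => xi /=.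
rewrite map_mxM; congr (_ *m _); apply/matrixP=> i j; rewrite !mxE /=.
  by rewrite (mevalXU (fun j => v 0 j)) (ord1 i).
by rewrite mevalC.
Qed.

Definition Phic (eta : ext C d) : mpoly d C :=
  map_mpoly (real_complex R) (Phi (ext_map (@complex.Re R) eta))
  + 'i%C *: map_mpoly (real_complex R) (Phi (ext_map (@complex.Im R) eta)).

Section Borel.
Context (t : {vspace g}).

(* A linear form on t^c is represented by any linear form on k^c extending it,
   as only its values on t^c matter. *)
Implicit Types (alpha : {scalar 'rV[C]_m}).

Definition root_vector alpha (z : 'rV[C]_m) :=
  forall h, h \in csub t -> cbracket h z = alpha h *: z.

Definition is_root alpha :=
  (exists2 h, h \in csub t & alpha h != 0) /\
  (exists2 z, z != 0 & root_vector alpha z).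

(* The roots take imaginary values on t.  A positive system is the set of
   roots that are positive on a regular element h0 of 'i t. *)
Definition positive_system (P : {scalar 'rV[C]_m} -> Prop) :=
  exists2 h0, h0 \in t &
    (forall alpha, is_root alpha -> complex.Im (alpha (cvec h0)) != 0) /\
    (forall alpha, P alpha <-> is_root alpha /\ 0 < complex.Im (alpha (cvec h0))).

Context (P : {scalar 'rV[C]_m} -> Prop).

(* b is the sum of t^c and of the root spaces of the roots in P. *)
Definition borel_subalgebra (b : {vspace 'rV[C]_m}) :=
  let contains (b' : {vspace 'rV[C]_m}) :=
    (csub t <= b')%VS /\
    (forall alpha z, P alpha -> root_vector alpha z -> z \in b') in
  contains b /\ forall b', contains b' -> (b <= b')%VS.

Definition stable_under (b : {vspace 'rV[C]_m}) (v : {vspace 'rV[C]_d}) :=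
  forall z u, z \in b -> u \in v -> cact z u \in v.

Definition highest_weight_vector (w : ext C d) :=
  [/\ w != 0,
      exists lambda : {scalar 'rV[C]_m},
        forall h, h \in csub t -> ext_act (adc e h) w = lambda h *: w
    & forall alpha z, P alpha -> root_vector alpha z ->
        ext_act (adc e z) w = 0].

End Borel.

Definition ext_submodule (W : {vspace ext C d}) :=
  forall z a, a \in W -> ext_act (adc e z) a \in W.

Definition irreducible_component (r : nat) (W : {vspace ext C d}) :=
  [/\ forall a, a \in W -> ext_degree r a, ext_submodule W, W != 0%VS
    & forall U : {vspace ext C d},
        (U <= W)%VS -> ext_submodule U -> U = 0%VS \/ U = W].

End Complexification.

(* Main.v *)
Require Import Defs.
From HB Require Import structures.
From mathcomp Require Import all_boot all_order all_algebra.
From mathcomp Require Import reals boolp topology normedtype sequences.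
From mathcomp Require Import derive realfun exp.
From mathcomp Require Import complex ring zify.
From mathcomp Require Import -(notations) mpoly.

Set Implicit Arguments.
Unset Strict Implicit.
Unset Printing Implicit Defensive.

Import Order.TTheory GRing.Theory Num.Theory numFieldNormedType.Exports.
Local Open Scope ring_scope.
Local Open Scope complex_scope.

(* Write D_z for the action of z in k^c on the exterior algebra of p^c, and w for
   u_1 /\ ... /\ u_r.

   Highest weight.  As v is b-stable, w is an eigenvector of every D_z with z in b.
   If z is a root vector of a positive root alpha, then [D_h, D_z] w = 0 for h in
   t^c, that is, alpha(h) D_z w = 0, hence D_z w = 0.

   Irreducibility.  Let n be the span of the positive root vectors, so that
   k^c = b + conj(n).  The smallest subspace W containing w and stable under
   conj(n) is a k^c-module, and W is contained in C w + conj(n) W.  The Hermitian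
   product of Lambda p^c is such that the adjoint of D_z is - D_(conj z), so an
   element of W killed by n is determined by its product with w, hence is a
   multiple of w.  If U is a submodule of W, the orthogonal projection of w to U is
   killed by n, so it is 0 or generates W.

   Non-vanishing.  Maximal rank provides y0 in p such that z |-> [z, y0] is
   injective on k, and d = m + r.  So for a generic y in p^c both this injectivity
   and the independence of the (df_i)_y on v hold.  The tangent space [k^c, y] is
   annihilated by all (df_i)_y, hence meets v trivially: the m vectors [x_i, y] and
   the r vectors u_j form a basis of p^c, and Phi^c(w)(y), which is the coordinate
   of w /\ [x_1, y] /\ ... /\ [x_m, y] on the volume form, is not 0. *)

(** * The exterior algebra *)

Section ExteriorAlgebra.
Context (A : comNzRingType) (d : nat).
Implicit Types (S T : {set 'I_d}) (a b : ext A d) (u v : 'rV[A]_d) (M N : 'M[A]_d).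
Implicit Types (us vs : seq 'rV[A]_d).

(* (-1) ^+ nbelow j S is the sign of e_j /\ e_S. *)
Definition nbelow (j : 'I_d) S : nat := #|[set k in S | (k < j)%N]|.

Lemma nbelowD1 j k S : nbelow j S = (((k \in S) && (k < j)) + nbelow j (S :\ k))%N.
Proof.
rewrite /nbelow (cardsD1 k) inE; congr (_ + _)%N.
by congr #|pred_of_set _|; apply/setP => l; rewrite !inE andbA.
Qed.

Lemma nbelowD1_id j S : nbelow j (S :\ j) = nbelow j S.
Proof. by rewrite [RHS](nbelowD1 j j) ltnn andbF. Qed.

Lemma nbelowU1 j k S : k \notin S ->
  nbelow j (k |: S) = ((k < j) + nbelow j S)%N.
Proof. by move=> kS; rewrite (nbelowD1 j k) setU11 setU1K. Qed.

Lemma nbelowU1_id j S : nbelow j (j |: S) = nbelow j S.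
Proof.
by congr #|pred_of_set _|; apply/setP => k; rewrite !inE; case: (k =P j) => [->|//];
  rewrite ltnn !andbF.
Qed.

Definition creation (j : 'I_d) a : ext A d :=
  [ffun S : {set 'I_d} => if j \in S then (-1) ^+ nbelow j S * (a (S :\ j) : A) else 0].

(* Contraction by the i-th coordinate form, so that the canonical anticommutation
   relations with creation hold. *)
Definition annihilation (i : 'I_d) a : ext A d :=
  [ffun S : {set 'I_d} => if i \in S then 0 else (-1) ^+ nbelow i S * (a (i |: S) : A)].

Lemma creation_linear j : linear (creation j).
Proof.
move=> c a a'; apply/ffunP => S; rewrite !ffunE /GRing.scale /=.
by case: ifP => _; [rewrite mulrDr !mulrA (mulrC c) | rewrite mulr0 addr0].
Qed.
HB.instance Definition _ j :=
  GRing.isLinear.Build A (ext A d) (ext A d) *:%R (creation j) (creation_linear j).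

Lemma annihilation_linear i : linear (annihilation i).
Proof.
move=> c a a'; apply/ffunP => S; rewrite !ffunE /GRing.scale /=.
by case: ifP => _; [rewrite mulr0 addr0 | rewrite mulrDr !mulrA (mulrC c)].
Qed.
HB.instance Definition _ i :=
  GRing.isLinear.Build A (ext A d) (ext A d) *:%R (annihilation i) (annihilation_linear i).

Lemma creation_anti j k a : creation j (creation k a) = - creation k (creation j a).
Proof.
apply/ffunP => S; rewrite !ffunE !inE.
have [<-|jk] := eqVneq j k; first by rewrite /= mulr0 if_same oppr0.
rewrite /=; have [jS|jS] := ifPn (j \in S); have [kS|kS] := ifPn (k \in S);
  rewrite ?mulr0 ?oppr0 //.
rewrite (nbelowD1 j k S) (nbelowD1 k j S) jS kS /= !mulrA setDDl setUC -setDDl.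
rewrite !exprD -mulNr; congr (_ * _).
move: (_ ^+ nbelow j _) (_ ^+ nbelow k _) => s1 s2.
by case: (ltngtP j k) jk => [jk|jk|/val_inj ->] //=; rewrite ?eqxx //= => _; ring.
Qed.

Lemma creation_sq j a : creation j (creation j a) = 0.
Proof.
by apply/ffunP => S; rewrite !ffunE !inE eqxx /= mulr0 if_same.
Qed.

Lemma annihilation_creation i j a : annihilation i (creation j a) =
  (i == j)%:R *: a - creation j (annihilation i a).
Proof.
apply/ffunP => S; rewrite !ffunE !inE /GRing.scale /=.
have [<-|ij] := eqVneq i j.
  rewrite mul1r /=; have [iS|iS] := ifPn (i \in S).
    rewrite /= nbelowD1_id mulrA -expr2 sqrr_sign mul1r setD1K ?subrr //.
  by rewrite subr0 mulrA nbelowU1_id -expr2 sqrr_sign mul1r setU1K.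
rewrite mul0r add0r /=.
have [iS|iS] := ifPn (i \in S); have [jS|jS] := ifPn (j \in S);
  rewrite ?mulr0 ?oppr0 //.
rewrite (nbelowU1 _ iS) (nbelowD1 i j S) jS /= -mulNr !mulrA.
have -> : (i |: S) :\ j = i |: S :\ j.
  apply/setP => k; rewrite !inE; case: (k =P i) => [->|//]; first by rewrite ij.
rewrite !exprD; congr (_ * _).
move: (_ ^+ nbelow i _) (_ ^+ nbelow j _) => s1 s2.
by case: (ltngtP j i) ij => [jk|jk|/val_inj ->] //=; rewrite ?eqxx //= => _; ring.
Qed.

Lemma inversions1 j T : inversions [set j] T = nbelow j T.
Proof.
rewrite /inversions /nbelow -(card_imset [set k in T | (k < j)%N] (f := fun k => (j, k)));
  last by move=> k l [].
apply: eq_card => -[k l]; rewrite inE /=; apply/idP/imsetP.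
  by case/and3P => /set1P -> lT lj; exists l => //; rewrite inE lT.
by case=> l'; rewrite inE => /andP[lT lj] [-> ->]; rewrite set11 lT.
Qed.

Lemma ext_mul_vecE u a : ext_mul (ext_vec u) a = \sum_j u 0 j *: creation j a.
Proof.
apply/ffunP => S; rewrite ffunE sum_ffunE.
under eq_bigr => T TS do rewrite ffunE mulr_sumr mulr_suml.
rewrite (exchange_big_dep predT) //=; apply: eq_bigr => j _.
rewrite !ffunE /GRing.scale /=; have [jS|jS] := ifPn (j \in S).
  rewrite (big_pred1 [set j]); first by rewrite inversions1 nbelowD1_id -mulrA mulrCA.
  by move=> T /=; have [->|] := eqVneq T [set j]; rewrite ?andbF // andbT sub1set.
rewrite mulr0 big_pred0 // => T; apply/andP => -[TS /eqP TE].
by move: TS; rewrite TE sub1set (negPf jS).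
Qed.

Definition ext_mulr b a := ext_mul a b.
Lemma ext_mul_linearl b : linear (ext_mulr b).
Proof.
rewrite /ext_mulr; move=> c a a'; apply/ffunP => S;
  rewrite !ffunE /GRing.scale /= mulr_sumr -big_split /=.
by apply: eq_bigr => T _; rewrite !ffunE /GRing.scale /=; ring.
Qed.
HB.instance Definition _ b := GRing.isLinear.Build A (ext A d) (ext A d) *:%R
  (ext_mulr b) (ext_mul_linearl b).

Lemma ext_mul_linearr a : linear (ext_mul a).
Proof.
move=> c b b'; apply/ffunP => S; rewrite !ffunE /GRing.scale /= mulr_sumr -big_split /=.
by apply: eq_bigr => T _; rewrite !ffunE /GRing.scale /=; ring.
Qed.
HB.instance Definition _ a := GRing.isLinear.Build A (ext A d) (ext A d) *:%R
  (ext_mul a) (ext_mul_linearr a).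

Definition ext_vec_mul a u := ext_mul (ext_vec u) a.
Lemma ext_mul_vec_linear a : linear (ext_vec_mul a).
Proof.
rewrite /ext_vec_mul; move=> c u u'; rewrite !ext_mul_vecE scaler_sumr -big_split /=.
by apply: eq_bigr => j _; rewrite !mxE scalerDl scalerA.
Qed.
HB.instance Definition _ a := GRing.isLinear.Build A 'rV[A]_d (ext A d) *:%R
  (ext_vec_mul a) (ext_mul_vec_linear a).

Lemma ext_mul_vec_anti u v a :
  ext_mul (ext_vec u) (ext_mul (ext_vec v) a) = - ext_mul (ext_vec v) (ext_mul (ext_vec u) a).
Proof.
rewrite !ext_mul_vecE.
under eq_bigr => j _ do rewrite linear_sum scaler_sumr.
rewrite exchange_big -sumrN; apply: eq_bigr => k _ /=.
rewrite linear_sum scaler_sumr -sumrN; apply: eq_bigr => j _ /=.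
by rewrite !linearZ /= creation_anti !scalerN !scalerA mulrC.
Qed.

Lemma ext_mul_vec_sq u a : ext_mul (ext_vec u) (ext_mul (ext_vec u) a) = 0.
Proof.
rewrite !ext_mul_vecE.
under eq_bigr => j _ do rewrite linear_sum scaler_sumr.
rewrite pair_big /= (bigID (fun p : 'I_d * 'I_d => (p.1 < p.2)%N)) /=.
rewrite [X in _ + X](bigID (fun p : 'I_d * 'I_d => (p.2 < p.1)%N)) /=.
rewrite [X in _ + (_ + X)]big1 ?addr0; last first.
  case=> j k /=; rewrite -!leqNgt => /andP[kj jk].
  have -> : j = k by apply/val_inj/anti_leq; rewrite jk kj.
  by rewrite linearZ /= creation_sq !scaler0.
rewrite [X in _ + X](reindex_inj (_ : injective (fun p : 'I_d * 'I_d => (p.2, p.1)))) /=;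
  last by case=> ? ? [? ?] [-> ->].
rewrite [X in _ + X](eq_bigl (fun p : 'I_d * 'I_d => (p.1 < p.2)%N)); last first.
  by case=> j k /=; case: ltngtP.
rewrite -big_split big1 //= => -[j k] _ /=.
by rewrite !linearZ /= creation_anti !scalerN !scalerA mulrC addNr.
Qed.

Definition contract (phi : 'cV[A]_d) a : ext A d := \sum_i phi i 0 *: annihilation i a.

Lemma contract_mul_vec phi u a :
  contract phi (ext_mul (ext_vec u) a) =
  (u *m phi) 0 0 *: a - ext_mul (ext_vec u) (contract phi a).
Proof.
rewrite /contract !ext_mul_vecE.
under eq_bigr => i _ do rewrite linear_sum scaler_sumr.
rewrite exchange_big mxE scaler_suml -sumrB; apply: eq_bigr => j _ /=.
rewrite linear_sum scaler_sumr /= (eq_bigr (fun i => (phi i 0 * u 0 j * (i == j)%:R) *: a - u 0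
  j *: creation j (phi i 0 *: annihilation i a))); last first.
  by move=> i _; rewrite !linearZ /= annihilation_creation !scalerBr !scalerA scalerN (mulrC (u
    0 j)).
rewrite sumrB; congr (_ - _).
rewrite (bigD1 j) //= eqxx mulr1 big1 ?addr0 1?mulrC // => i /negPf ->.
by rewrite mulr0 scale0r.
Qed.

Lemma contract_one phi : contract phi (ext_one A d) = 0.
Proof.
rewrite /contract big1 // => i _; rewrite (_ : annihilation i _ = 0) ?scaler0 //.
apply/ffunP => S; rewrite !ffunE; case: ifP => // _.
by rewrite (negPf (_ : i |: S != finset.set0)) ?mulr0 //; apply/set0Pn; exists i; rewrite setU11.
Qed.

Lemma inversionsU1 j S T : j \notin S ->
  inversions (j |: S) T = (nbelow j T + inversions S T)%N.
Proof.
move=> jS; rewrite -inversions1 /inversions -cardsUI [X in (_ + X)%N](_ : _ = 0)%N ?addn0.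
  by congr #|pred_of_set _|; apply/setP => -[k l]; rewrite !inE /= andb_orl.
apply/eqP; rewrite cards_eq0; apply/eqP/setP => -[k l]; rewrite !inE /=.
by case: eqP => // ->; rewrite (negPf jS) andbF.
Qed.

Lemma nbelowU j S T : [disjoint S & T] ->
  nbelow j (S :|: T) = (nbelow j S + nbelow j T)%N.
Proof.
move=> dST; rewrite /nbelow -cardsUI [X in (_ + X)%N](_ : _ = 0)%N ?addn0.
  by congr #|pred_of_set _|; apply/setP => k; rewrite !inE andb_orl.
apply/eqP; rewrite cards_eq0; apply/eqP/setP => k; rewrite !inE /=.
by case: (boolP (k \in S)) => // /(disjointFr dST) ->; rewrite !andbF.
Qed.

Lemma ext_mul_creation j a b : ext_mul (creation j a) b = creation j (ext_mul a b).
Proof.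
apply/ffunP => S; rewrite !ffunE; have [jS|jS] := ifPn (j \in S); last first.
  rewrite big1 // => T TS; rewrite !ffunE ifN ?mulr0 ?mul0r //.
  by apply: contraNN jS => /(subsetP TS).
rewrite (bigID (fun T : {set 'I_d} => j \in T)) /= [X in _ + X]big1 ?addr0; last first.
  by move=> T /andP[_ jT]; rewrite ffunE (negPf jT) mulr0 mul0r.
rewrite mulr_sumr (reindex_onto (fun T : {set 'I_d} => j |: T) (fun T : {set 'I_d} => T :\ j))
  /=; last first.
  by move=> T /andP[_ jT]; rewrite setD1K.
apply: eq_big => [T|T].
  rewrite setU11 andbT subUset sub1set jS /=; apply/andP/idP => [[TS /eqP jT]|TS].
    by rewrite subsetD1 TS; apply/negP => jT'; move: jT => /setP/(_ j); rewrite !inE eqxx jT'.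
  by move: TS; rewrite subsetD1 => /andP[-> jT]; rewrite setU1K.
rewrite setU11 andbT subUset sub1set jS /= => /andP[TS /eqP jT].
have njT : j \notin T by rewrite -jT !inE eqxx.
rewrite ffunE setU11 jT nbelowU1_id setDDl inversionsU1 //.
have -> : nbelow j S = (nbelow j T + nbelow j (S :\: (j |: T)))%N.
  rewrite -(nbelowU1_id j T) -nbelowU; last first.
    by rewrite -setI_eq0 setDE setICA setICr setI0.
  rewrite -{1}(setID S (j |: T)); congr (nbelow _ (_ :|: _)).
  by apply/setIidPr; rewrite subUset sub1set jS.
rewrite !exprD; ring.
Qed.

Lemma ext_mul_vecA u a b :
  ext_mul (ext_mul (ext_vec u) a) b = ext_mul (ext_vec u) (ext_mul a b).
Proof.
rewrite !ext_mul_vecE -[LHS]/(ext_mulr b _) linear_sum; apply: eq_bigr => j _.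
by rewrite linearZ /= /ext_mulr ext_mul_creation.
Qed.

Lemma ext_one_mul b : ext_mul (ext_one A d) b = b.
Proof.
apply/ffunP => S; rewrite ffunE (bigD1 finset.set0) ?sub0set //= big1 ?addr0.
  rewrite ffunE eqxx mulr1 setD0 /inversions.
  rewrite (_ : [set _ | _] = finset.set0) ?cards0 ?mul1r //.
  by apply/setP => p; rewrite !inE.
by move=> T /andP[_ /negPf T0]; rewrite ffunE T0 mulr0 mul0r.
Qed.

Lemma wedge_cat us vs : wedge (us ++ vs) = ext_mul (wedge us) (wedge vs).
Proof.
by elim: us => [|u us IH] /=; rewrite ?ext_one_mul // IH ext_mul_vecA.
Qed.

Definition ext_basis S : ext A d := [ffun T => (T == S)%:R].

Lemma ext_basisE a : a = \sum_S (a S : A) *: ext_basis S.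
Proof.
apply/ffunP => T; rewrite sum_ffunE (bigD1 T) //= !ffunE eqxx /GRing.scale /= mulr1 big1 ?addr0
  //.
by move=> S /negPf ST; rewrite !ffunE eq_sym ST scaler0.
Qed.

Lemma ext_vec_delta j a : ext_mul (ext_vec (delta_mx 0 j)) a = creation j a.
Proof.
rewrite ext_mul_vecE (bigD1 j) //= big1 ?addr0 ?mxE ?eqxx ?scale1r // => k /negPf kj.
by rewrite mxE kj andbF scale0r.
Qed.

Lemma creation_ext_basis j S : j \notin S ->
  creation j (ext_basis S) = (-1) ^+ nbelow j S *: ext_basis (j |: S).
Proof.
move=> jS; apply/ffunP => T; rewrite !ffunE /GRing.scale /=.
have [jT|jT] := ifPn (j \in T).
  have -> : (T :\ j == S) = (T == j |: S).
    by apply/eqP/eqP => [<-|->]; rewrite ?setD1K ?setU1K.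
  by case: eqP => [->|]; rewrite ?mulr0 // nbelowU1_id.
case: eqP => [TE|]; rewrite ?mulr0 //.
by move: jT; rewrite TE setU11.
Qed.

Lemma wedge_sorted (s : seq 'I_d) : sorted (fun i j : 'I_d => (i < j)%N) s ->
  wedge [seq delta_mx 0 j | j <- s] = ext_basis [set j in s].
Proof.
elim: s => [_|j s IH js] /=.
  by apply/ffunP => S; rewrite !ffunE; congr (_ == _)%:R; apply/setP => i; rewrite !inE.
have tr : transitive (fun i j : 'I_d => (i < j)%N) by move=> k i l; apply: ltn_trans.
move: (js); rewrite /= (path_sortedE tr) => /andP[/allP js1 js2].
rewrite IH // ext_vec_delta creation_ext_basis; last first.
  by rewrite inE; apply/negP => /js1; rewrite ltnn.
rewrite (_ : nbelow j _ = 0)%N ?scale1r; first by congr ext_basis; apply/setP => i; rewrite !inE.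
apply/eqP; rewrite cards_eq0; apply/eqP/setP => k; rewrite !inE.
by apply/andP => -[/js1]; rewrite ltnNge => /negP kj /ltnW.
Qed.

Lemma wedge_enum S : wedge [seq delta_mx 0 j | j <- enum S] = ext_basis S.
Proof.
rewrite wedge_sorted; first by congr ext_basis; apply/setP => j; rewrite inE mem_enum.
rewrite /enum_mem -enumT /=; apply: sorted_filter; first by move=> k i l; apply: ltn_trans.
by have := iota_ltn_sorted 0 d; rewrite -val_enum_ord sorted_map.
Qed.

Lemma ext_ind (Q : ext A d -> Prop) :
  (forall c a b, Q a -> Q b -> Q (c *: a + b)) -> Q (ext_one A d) ->
  (forall j a, Q a -> Q (creation j a)) -> forall a, Q a.
Proof.
move=> Ql Q1 Qc a.
have Q0 : Q 0 by have := Ql (-1) _ _ Q1 Q1; rewrite scaleN1r addNr.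
rewrite (ext_basisE a); elim/big_rec: _ => // S b _; apply: Ql.
rewrite -wedge_enum; elim: (enum S) => //= j s IH.
by rewrite ext_vec_delta; apply: Qc.
Qed.

Lemma annihilation_wedge_notin i (s : seq 'I_d) : i \notin s ->
  annihilation i (wedge [seq delta_mx 0 j | j <- s]) = 0.
Proof.
have E a : annihilation i a = contract (delta_mx i 0) a.
  rewrite /contract (bigD1 i) //= mxE !eqxx scale1r big1 ?addr0 // => k /negPf ki.
  by rewrite mxE ki scale0r.
elim: s => [_|j s IH] /=; first by rewrite E contract_one.
rewrite inE negb_or => /andP[/negPf ij /IH iS].
by rewrite ext_vec_delta annihilation_creation ij scale0r iS linear0 subr0.
Qed.

Lemma wedge_replace i v (s : seq 'I_d) : uniq s -> i \in s ->
  wedge [seq if j == i then v else delta_mx 0 j | j <- s] =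
  ext_mul (ext_vec v) (annihilation i (wedge [seq delta_mx 0 j | j <- s])).
Proof.
elim: s => //= j s IH /andP[js us]; rewrite inE ext_vec_delta annihilation_creation eq_sym.
have [ij|ji] /= := eqVneq i j.
  move: js; rewrite -ij => js _; rewrite annihilation_wedge_notin // linear0 subr0 scale1r.
  congr (ext_mul _ (wedge _)); apply/eq_in_map => k ks.
  by case: eqP => // ki; rewrite -ki ks in js.
by move=> si; rewrite IH // scale0r sub0r -ext_vec_delta linearN /= ext_mul_vec_anti.
Qed.

Lemma ext_actE M a : ext_act M a = \sum_i ext_mul (ext_vec (row i M)) (annihilation i a).
Proof.
rewrite {2}(ext_basisE a) /ext_act.
under [RHS]eq_bigr => i _ do rewrite !linear_sum.
rewrite exchange_big; apply: eq_bigr => S _.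
under [RHS]eq_bigr => i _ do rewrite linearZ linearZ /=.
rewrite -scaler_sumr; congr (_ *: _).
rewrite big_mkcond; apply: eq_bigr => i _; case: ifP => iS; last first.
  by rewrite -wedge_enum annihilation_wedge_notin ?mem_enum ?iS // linear0.
rewrite -wedge_enum -wedge_replace ?enum_uniq ?mem_enum //.
by congr wedge; apply: eq_map => j; case: eqP => // ->; rewrite rowE.
Qed.

Lemma ext_act_linear M : linear (ext_act M).
Proof.
move=> c a b; rewrite !ext_actE scaler_sumr -big_split; apply: eq_bigr => i _ /=.
by rewrite !linearP.
Qed.
HB.instance Definition _ M := GRing.isLinear.Build A (ext A d) (ext A d) *:%R
  (@ext_act A d M) (ext_act_linear M).

Lemma ext_act_mxP c M N a : ext_act (c *: M + N) a = c *: ext_act M a + ext_act N a.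
Proof.
rewrite !ext_actE scaler_sumr -big_split; apply: eq_bigr => i _ /=.
by rewrite -![ext_mul (ext_vec _) _]/(ext_vec_mul _ _) !linearP.
Qed.

Lemma ext_act_mxZ c M a : ext_act (c *: M) a = c *: ext_act M a.
Proof.
rewrite !ext_actE scaler_sumr; apply: eq_bigr => i _ /=.
by rewrite -![ext_mul (ext_vec _) _]/(ext_vec_mul _ _) !linearZ.
Qed.

Lemma ext_actZ M c a : ext_act M (c *: a) = c *: ext_act M a.
Proof. exact: linearZ. Qed.

Lemma ext_act_mxN M a : ext_act (- M) a = - ext_act M a.
Proof.
apply/eqP; rewrite -addr_eq0 -[ext_act M a]scale1r addrC -ext_act_mxP scale1r subrr.
by rewrite ext_actE big1 // => i _; rewrite linear0 -[LHS]/(ext_vec_mul _ _) linear0.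
Qed.

Lemma ext_act_one M : ext_act M (ext_one A d) = 0.
Proof.
rewrite ext_actE big1 // => i _; rewrite -[ext_one A d]/(wedge [seq delta_mx 0 j | j <- [::]]).
by rewrite annihilation_wedge_notin // linear0.
Qed.

Lemma annihilation_ext_vec i u a :
  annihilation i (ext_mul (ext_vec u) a) = u 0 i *: a - ext_mul (ext_vec u) (annihilation i a).
Proof.
rewrite !ext_mul_vecE linear_sum (eq_bigr (fun j => (u 0 j * (i == j)%:R) *: a - u 0 j *:
  creation j (annihilation i a))); last first.
  by move=> j _; rewrite linearZ /= annihilation_creation scalerBr scalerA.
rewrite sumrB; congr (_ - _).
rewrite (bigD1 i) //= eqxx mulr1 big1 ?addr0 // => j /negPf ji.
by rewrite eq_sym ji mulr0 scale0r.
Qed.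

Lemma ext_act_vec M u a :
  ext_act M (ext_mul (ext_vec u) a) =
  ext_mul (ext_vec (u *m M)) a + ext_mul (ext_vec u) (ext_act M a).
Proof.
rewrite !ext_actE linear_sum mulmx_sum_row -[in RHS]/(ext_vec_mul _ _) linear_sum -big_split.
apply: eq_bigr => i _ /=; rewrite annihilation_ext_vec linearB !linearZ /=; congr (_ + _).
by rewrite ext_mul_vec_anti opprK.
Qed.

Lemma ext_act_comm M N a :
  ext_act M (ext_act N a) - ext_act N (ext_act M a) = ext_act (N *m M - M *m N) a.
Proof.
elim/ext_ind: a => [c a b IHa IHb||j a IH].
- by rewrite !linearP /= -IHa -IHb scalerBr scalerN addrACA.
- by rewrite !ext_act_one !linear0 addr0.
rewrite -ext_vec_delta !ext_act_vec linearD (linearD (ext_act N)) /= !ext_act_vec -IH mulmxBr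
  !mulmxA (linearB (ext_mul _)) /=.
rewrite -![ext_mul (ext_vec _) a]/(ext_vec_mul _ _) linearB /=.
set p1 := ext_vec_mul _ _; set p2 := ext_mul (ext_vec (delta_mx 0 j *m N)) _.
set p3 := ext_mul (ext_vec (delta_mx 0 j *m M)) _.
rewrite !opprD (AC ((2*2)*(2*2)) ((1*5)*(4*8)*((2*7)*(3*6)))) /=.
by rewrite !subrr !addr0.
Qed.

Lemma ext_degreeP k c a b :
  ext_degree k a -> ext_degree k b -> ext_degree k (c *: a + b).
Proof.
move=> ka kb S; rewrite !ffunE /GRing.scale /=.
have [aS|/ka//] := eqVneq (a S) 0; rewrite aS mulr0 add0r; exact: kb.
Qed.

Lemma ext_degree0 k : ext_degree k (0 : ext A d).
Proof. by move=> S; rewrite ffunE eqxx. Qed.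

Lemma ext_degree_sum k (I : finType) (F : I -> ext A d) :
  (forall i, ext_degree k (F i)) -> ext_degree k (\sum_i F i).
Proof.
move=> kF; elim/big_rec: _ => [|i a _ ka]; first exact: ext_degree0.
by rewrite -[F i]scale1r; apply: ext_degreeP.
Qed.

Lemma ext_degree_vec k u a : ext_degree k a -> ext_degree k.+1 (ext_mul (ext_vec u) a).
Proof.
move=> ka; rewrite ext_mul_vecE; apply: ext_degree_sum => j.
rewrite -[_ *: _]addr0; apply: ext_degreeP (ext_degree0 _) => S; rewrite ffunE.
case: ifP => [jS|]; last by rewrite eqxx.
rewrite (cardsD1 j) jS; have [aS|/ka <-//] := eqVneq (a (S :\ j)) 0.
by rewrite aS mulr0 eqxx.
Qed.

Lemma ext_degree_act k M a : ext_degree k a -> ext_degree k (ext_act M a).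
Proof.
move=> ka; rewrite ext_actE; apply: ext_degree_sum => i.
case: k ka => [|k] ka.
  rewrite (_ : annihilation i a = 0) ?linear0; first exact: ext_degree0.
  apply/ffunP => S; rewrite !ffunE; case: ifP => // _.
  have [->|/ka/eqP] := eqVneq (a (i |: S)) 0; rewrite ?mulr0 //.
  by rewrite cards_eq0 => /eqP/setP/(_ i); rewrite !inE eqxx.
apply: ext_degree_vec => S; rewrite ffunE; case: ifP => [|iS]; rewrite ?eqxx //.
have [->|/ka] := eqVneq (a (i |: S)) 0; rewrite ?mulr0 ?eqxx //.
by rewrite cardsU1 iS /= => -[].
Qed.

Lemma ext_degree_wedge us : ext_degree (size us) (wedge us).
Proof.
elim: us => [|u us IH] /=; last exact: ext_degree_vec.
by move=> S; rewrite ffunE; case: (S =P finset.set0) => [->|]; rewrite ?cards0 ?eqxx.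
Qed.

Lemma ext_dot_hodge a b : ext_dot a (hodge b) = ext_mul b a setT.
Proof.
rewrite /ext_dot ffunE (reindex_inj (@setC_inj _)); apply: eq_big => S.
  by rewrite subsetT.
by rewrite ffunE setTD setCK => _; ring.
Qed.

Lemma ext_mul_wedge_cat us vs a :
  ext_mul (wedge (us ++ vs)) a = ext_mul (wedge us) (ext_mul (wedge vs) a).
Proof.
by elim: us => [|u us IH] /=; rewrite ?ext_one_mul // !ext_mul_vecA IH.
Qed.

Lemma ext_mul_wedge_vec us v a :
  ext_mul (wedge us) (ext_mul (ext_vec v) a) =
  (-1) ^+ size us *: ext_mul (ext_vec v) (ext_mul (wedge us) a).
Proof.
elim: us => [|u us IH] /=; first by rewrite !ext_one_mul scale1r.
by rewrite !ext_mul_vecA IH linearZ /= ext_mul_vec_anti exprS mulN1r scaleNr scalerN.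
Qed.

Lemma ext_vec_wedge_mem us v a : v \in us ->
  ext_mul (ext_vec v) (ext_mul (wedge us) a) = 0.
Proof.
elim: us => //= u us IH; rewrite inE => /predU1P[->|/IH vus].
  by rewrite ext_mul_vecA ext_mul_vec_sq.
by rewrite ext_mul_vecA ext_mul_vec_anti vus linear0 oppr0.
Qed.

Lemma ext_mul_one a : ext_mul a (ext_one A d) = a.
Proof.
elim/ext_ind: a => [c a b IHa IHb||j a IH]; last by rewrite ext_mul_creation IH.
  by rewrite -[LHS]/(ext_mulr _ _) linearP /= /ext_mulr IHa IHb.
exact: ext_one_mul.
Qed.

End ExteriorAlgebra.

Section ExteriorField.
Context (F : fieldType) (d : nat).
Implicit Types (us vs : seq 'rV[F]_d) (u v : 'rV[F]_d) (M : 'M[F]_d).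

Lemma free_dual u us : free (u :: us) ->
  exists phi : 'cV[F]_d, (u *m phi) 0 0 = 1 /\ (forall v, v \in us -> (v *m phi) 0 0 = 0).
Proof.
move=> fus; pose X := in_tuple (u :: us).
pose phi : 'cV[F]_d := \col_i coord X ord0 (delta_mx 0 i).
have phiE v : (v *m phi) 0 0 = coord X ord0 v.
  rewrite mxE {2}(row_sum_delta v) linear_sum; apply: eq_bigr => i _.
  by rewrite linearZ mxE.
exists phi; split; rewrite ?phiE.
  by have := coord_free (X := X) ord0 ord0 fus; rewrite eqxx.
move=> v vus; rewrite phiE.
have vi : (index v us < size us)%N by rewrite index_mem.
have := coord_free (X := X) (lift ord0 (Ordinal vi)) ord0 fus.
by rewrite /= /bump /= nth_index.
Qed.

(* Contracting u /\ wedge us by a form that is 1 at u and 0 on us gives wedge us. *)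
Lemma wedge_neq0 us : free us -> wedge us != 0.
Proof.
elim: us => [_|u us IH fus] /=.
  by apply/eqP => /ffunP/(_ finset.set0); rewrite !ffunE eqxx => /eqP; rewrite oner_eq0.
have [phi [phiu phius]] := free_dual fus.
have C0 vs : (forall v, v \in vs -> (v *m phi) 0 0 = 0) -> contract phi (wedge vs) = 0.
  elim: vs => [|v vs IHv] hv /=; first exact: contract_one.
  rewrite contract_mul_vec hv ?mem_head // scale0r sub0r IHv ?linear0 ?oppr0 //.
  by move=> v' v'vs; rewrite hv // inE v'vs orbT.
have {}IH : wedge us != 0 by apply: IH; move: fus; rewrite free_cons => /andP[].
apply: contraNneq IH => w0.
have := contract_mul_vec phi u (wedge us); rewrite w0 phiu scale1r C0 // linear0 subr0.
by move=> <-; rewrite /contract big1 // => i _; rewrite linear0 scaler0.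
Qed.

Lemma wedge_neq0_top us : free us -> size us = d -> wedge us setT != 0.
Proof.
move=> /wedge_neq0 w0 sz; apply: contraNneq w0 => wT.
apply/eqP/ffunP => S; rewrite [RHS]ffunE; apply/eqP/negPn/negP => wS.
have := ext_degree_wedge wS; rewrite sz => cS.
suff ST : S = setT by rewrite ST wT eqxx in wS.
by apply/eqP; rewrite eqEcard subsetT cardsT card_ord cS leqnn.
Qed.

Lemma ext_act_wedge_stable M us :
  (forall u, u \in us -> u *m M \in <<us>>%VS) ->
  exists c, ext_act M (wedge us) = c *: wedge us.
Proof.
have L us1 u us2 v : v \in <<us1 ++ u :: us2>>%VS ->
    exists c, ext_mul (wedge us1) (ext_mul (ext_vec v) (wedge us2)) =
      c *: wedge (us1 ++ u :: us2).
  rewrite -[us1 ++ _ in X in X -> _]/(tval (in_tuple (us1 ++ u :: us2))) => /coord_span ->.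
  elim/big_rec: _ => [|i a _ [c IH]].
    by exists 0; rewrite -[ext_mul (ext_vec 0) _]/(ext_vec_mul _ _) !linear0 scale0r.
  rewrite -[ext_mul (ext_vec _) _]/(ext_vec_mul _ _) !linearP /= /ext_vec_mul IH.
  set vi := _`_i; have: vi \in us1 ++ u :: us2 by apply: mem_nth.
  rewrite mem_cat inE => /or3P[vi1|/eqP->|vi2].
  - by rewrite ext_mul_wedge_vec ext_vec_wedge_mem // !scaler0 add0r; exists c.
  - rewrite -[ext_mul (ext_vec u) _]/(wedge (u :: us2)) -wedge_cat -scalerDl.
    by eexists.
  - rewrite -[wedge us2]ext_mul_one ext_vec_wedge_mem // linear0 scaler0 add0r.
    by exists c.
move=> Mus.
suff H us1 us2 : us1 ++ us2 = us ->
  exists c, ext_mul (wedge us1) (ext_act M (wedge us2)) = c *: wedge us.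
  by have := H [::] us erefl; rewrite ext_one_mul.
elim: us2 us1 => [|u us2 IH] us1 usE /=.
  by exists 0; rewrite ext_act_one linear0 scale0r.
rewrite ext_act_vec linearD /=.
have [|c1 ->] := L us1 u us2 (u *m M).
  by rewrite usE Mus // -usE mem_cat mem_head orbT.
have [|c2] := IH (rcons us1 u); first by rewrite cat_rcons.
rewrite -cats1 ext_mul_wedge_cat /= ext_mul_vecA ext_one_mul => ->.
by rewrite usE -scalerDl; eexists.
Qed.

End ExteriorField.

(** * Maximal rank *)

Section MaximalSubspace.
Context (F : fieldType) (V : vectType F).
Implicit Types (U : {vspace V}).

Lemma exists_maximal_subspace (Q : {vspace V} -> Prop) U0 : Q U0 ->
  exists U, [/\ (U0 <= U)%VS, Q U & forall U', Q U' -> (U <= U')%VS -> U' = U].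
Proof.
have [n] := ubnP (\dim {:V} - \dim U0)%N; elim: n U0 => // n IH U0 leU QU0.
have [[U' [QU' UU' neU]]|H] := pselect (exists U', [/\ Q U', (U0 <= U')%VS & U' <> U0]).
  have ltU : (\dim U0 < \dim U')%N.
    rewrite ltn_neqAle dimvS // andbT; apply/eqP => dE; apply: neU.
    by apply/esym/eqP; rewrite eqEdim UU' dE /=.
  have [|U [UU QU Umax]] := IH U' _ QU'.
    have := dimvS (subvf U'); lia.
  by exists U; split => //; apply: subv_trans UU.
exists U0; split => // U' QU' UU'; apply: contrapT => neU; apply: H.
by exists U'.
Qed.

Lemma predicate_subspace (Q : V -> Prop) : Q 0 ->
  (forall c u v, Q u -> Q v -> Q (c *: u + v)) ->
  exists U, forall u, u \in U <-> Q u.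
Proof.
move=> Q0 Ql; pose S U := forall u, u \in U -> Q u.
have S0 : S 0%VS by move=> u /[!memv0] /eqP ->.
have [U [_ SU Umax]] := exists_maximal_subspace S0.
exists U => u; split; first exact: SU.
move=> Qu; have SU' : S (<[u]> + U)%VS.
  by move=> v /memv_addP[w /vlineP[c ->] [w' w'U ->]]; apply: Ql => //; apply: SU.
rewrite -(Umax _ SU' (addvSr _ _)); apply: subvP (addvSl _ _) _ _; exact: memv_line.
Qed.

End MaximalSubspace.

Section Bracket.
Context (F : fieldType) (g : lieAlgebra F).
Implicit Types (x y z : g).

HB.instance Definition _ x := GRing.isLinear.Build F g g *:%R (bracket x) (bracket_linearr x).

Lemma bracketDl x x' y : bracket (x + x') y = bracket x y + bracket x' y.
Proof. by have := bracket_linearl y 1 x x'; rewrite /= !scale1r. Qed.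

Lemma bracket0l y : bracket (0 : g) y = 0.
Proof. by apply: (addrI (bracket 0 y)); rewrite -bracketDl !addr0. Qed.

Lemma bracketZl c x y : bracket (c *: x) y = c *: bracket x y.
Proof. by have := bracket_linearl y c x 0; rewrite /= !addr0 bracket0l addr0. Qed.

Lemma bracketNl x y : bracket (- x) y = - bracket x y.
Proof. by rewrite -scaleN1r bracketZl scaleN1r. Qed.

Lemma bracket_suml n (E : 'I_n -> g) y :
  bracket (\sum_i E i) y = \sum_i bracket (E i) y.
Proof. exact: (big_morph (fun x => bracket x y) (fun x x' => bracketDl x x' y) (bracket0l y)).
  Qed.

Lemma bracketC x y : bracket x y = - bracket y x.
Proof.
apply/eqP; rewrite -addr_eq0; have := bracket_alt (x + y).
by rewrite bracketDl !linearD /= !bracket_alt add0r addr0 => ->.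
Qed.

Lemma bracketA x y z :
  bracket (bracket x y) z = bracket x (bracket y z) - bracket y (bracket x z).
Proof.
rewrite (bracketC _ z); have := bracket_jacobi x y z.
move=> /eqP; rewrite addr_eq0 => /eqP <-.
by rewrite (bracketC z x) linearN.
Qed.

Lemma ad_mx_mul n (b : n.-tuple g) x y i j :
  (forall i, bracket y (tnth b i) \in <<b>>%VS) ->
  (ad_mx b y *m ad_mx b x) i j = coord b j (bracket x (bracket y (tnth b i))).
Proof.
move=> by_; rewrite [in RHS](coord_span (by_ i)) !linear_sum mxE; apply: eq_bigr => k _.
by rewrite !mxE !linearZ /= -tnth_nth.
Qed.

Lemma ad_mx_bracket n (b : n.-tuple g) x y :
  (forall i, bracket x (tnth b i) \in <<b>>%VS) ->
  (forall i, bracket y (tnth b i) \in <<b>>%VS) ->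
  ad_mx b (bracket x y) = ad_mx b y *m ad_mx b x - ad_mx b x *m ad_mx b y.
Proof.
move=> bx by_; apply/matrixP => i j; rewrite mxE bracketA linearB /=.
by rewrite -!ad_mx_mul // !mxE.
Qed.

Let b := vbasis {:g}.
Let adM x := ad_mx b x.

Let memb y i : bracket y (tnth b i) \in <<b>>%VS.
Proof. by rewrite (span_basis (vbasisP _)) memvf. Qed.

Lemma killing_tr x y : killing x y = \tr (adM y *m adM x).
Proof. by apply: eq_bigr => i _; rewrite ad_mx_mul. Qed.

Lemma killing_sym x y : killing x y = killing y x.
Proof. by rewrite !killing_tr mxtrace_mulC. Qed.

Lemma killing_inv x y z : killing (bracket x y) z = killing x (bracket y z).
Proof.
rewrite !killing_tr /adM !ad_mx_bracket // mulmxBr mulmxBl !raddfB /= !mulmxA.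
by congr (_ - _); rewrite mxtrace_mulC mulmxA.
Qed.

Lemma killing_linear x : linear (killing x : g -> F^o).
Proof.
move=> c y z; rewrite scaler_sumr -big_split; apply: eq_bigr => i _ /=.
by rewrite bracketDl bracketZl !linearP.
Qed.
HB.instance Definition _ x := GRing.isLinear.Build F g F^o *:%R (killing x) (killing_linear x).

Lemma killingZ x c y : killing x (c *: y) = c * killing x y.
Proof. by rewrite linearZ. Qed.

End Bracket.

Lemma poly_nonroot (F : numFieldType) (p : {poly F}) : p != 0 -> exists n : nat, p.[n%:R] != 0.
Proof.
move=> p0; apply: contrapT => H.
have := max_poly_roots p0 (rs := [seq n%:R | n <- iota 0 (size p)]).
rewrite size_map size_iota ltnn => rootsP; suff: false by []; apply: rootsP.
  apply/allP => _ /mapP[n _ ->]; apply/eqP; apply: contrapT => /eqP pn.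
  by apply: H; exists n.
by rewrite map_inj_uniq ?iota_uniq // => i j /eqP; rewrite eqr_nat => /eqP.
Qed.

Lemma horner_det_line (A : comNzRingType) n (M1 M2 : 'M[A]_n) s :
  (\det (map_mx polyC M1 + 'X *: map_mx polyC M2)).[s] = \det (M1 + s *: M2).
Proof.
rewrite -[_.[s]]/(horner_eval s _) -det_map_mx; congr (\det _).
apply/matrixP => i j; rewrite !mxE -[LHS]/(horner _ s).
by rewrite hornerD hornerM hornerX !hornerC.
Qed.

(* A basis of the row space of A and z *m B are the value at s = 0 of a family that,
   for s != 0, lies in the row space of A + s B; its independence persists for some
   s != 0. *)
Lemma rank_perturb (F : numFieldType) m d (A B : 'M[F]_(m, d)) (z : 'rV_m) :
  z *m A = 0 -> ~~ (z *m B <= A)%MS -> exists s, (\rank A < \rank (A + s *: B)%R)%N.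
Proof.
move=> zA zB; set rho := \rank A.
pose L := row_base A *m pinvmx A.
have LA : L *m A = row_base A by rewrite mulmxKpV // eq_row_base.
pose M0 := col_mx (row_base A) (z *m B); pose M1 := col_mx (L *m B) (0 : 'rV_d).
have M0f : row_free M0.
  rewrite -kermx_eq0 -submx0; apply/row_subP => i.
  have := row_sub i (kermx M0); set w := row i _ => /sub_kermxP.
  rewrite -[w]hsubmxK mul_row_col => wM.
  have r0 : rsubmx w = 0.
    apply: contraNeq zB => r0; apply/submxP.
    have [c cE] : exists c, rsubmx w = c%:M by exists (rsubmx w 0 0); rewrite -mx11_scalar.
    have c0 : c != 0 by apply: contra_neq r0 => c0; rewrite cE c0 raddf0.
    exists (- c^-1 *: (lsubmx w *m L)); rewrite -scalemxAl -mulmxA LA.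
    move: wM; rewrite cE mul_scalar_mx => /eqP; rewrite addr_eq0 => /eqP ->.
    by rewrite scalerN scaleNr opprK scalerA mulVf // scale1r.
  move: wM; rewrite r0 mul0mx addr0 => /eqP; rewrite mulmx_free_eq0 ?row_base_free // => /eqP ->.
  by rewrite row_mx0 sub0mx.
have [N M0N] := row_freeP M0f.
pose p := \det (map_mx polyC (M0 *m N) + 'X *: map_mx polyC (M1 *m N)).
have pE s : p.[s] = \det ((M0 + s *: M1) *m N).
  by rewrite horner_det_line mulmxDl scalemxAl.
have p0 : p != 0.
  by apply/eqP => p0; have := pE 0; rewrite p0 horner0 scale0r addr0 M0N det1 => /esym/eqP;
    rewrite oner_eq0.
have [n] : exists n : nat, ('X * p).[n%:R] != 0 by apply: poly_nonroot;
  rewrite mulf_neq0 ?polyX_eq0.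
rewrite hornerM hornerX mulf_eq0 negb_or => /andP[s0]; set s := n%:R; rewrite pE => ps.
exists s; have : row_free (M0 + s *: M1).
  apply/row_freeP; exists (N *m invmx ((M0 + s *: M1) *m N)).
  by rewrite mulmxA mulmxV // unitmxE unitfE.
move=> /eqP rk; apply: (@leq_trans (\rank (M0 + s *: M1)%R)); first by rewrite rk addn1.
apply: mxrankS.
rewrite scale_col_mx add_col_mx scaler0 addr0 col_mx_sub -LA scalemxAr -mulmxDr submxMl /=.
apply/submxP; exists (s^-1 *: z).
by rewrite mulmxDr -scalemxAl zA scaler0 add0r -scalemxAl -scalemxAr scalerA mulVf // scale1r.
Qed.

Section CartanInvolution.
Context (R : realType) (g : lieAlgebra R) (theta : 'End(g)).
Hypothesis cartan_theta : cartan_involution theta.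
Implicit Types (x y z : g) (h s : {vspace g}).
Local Notation k := (kpart theta).
Local Notation p := (ppart theta).

Lemma mem_kpart x : (x \in k) = (theta x == x).
Proof. by rewrite memv_ker !lfun_simp scale1r subr_eq0. Qed.

Lemma mem_ppart x : (x \in p) = (theta x == - x).
Proof. by rewrite memv_ker !lfun_simp scaleN1r opprK addr_eq0. Qed.

Lemma bracket_kk x y : x \in k -> y \in k -> bracket x y \in k.
Proof.
case: cartan_theta => tb _ _; rewrite !mem_kpart tb => /eqP -> /eqP ->.
exact: eqxx.
Qed.

Lemma bracket_kp x y : x \in k -> y \in p -> bracket x y \in p.
Proof.
case: cartan_theta => tb _ _; rewrite mem_kpart !mem_ppart tb => /eqP -> /eqP ->.
by rewrite linearN.
Qed.

Lemma bracket_pp x y : x \in p -> y \in p -> bracket x y \in k.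
Proof.
case: cartan_theta => tb _ _; rewrite mem_kpart !mem_ppart tb => /eqP -> /eqP ->.
by rewrite bracketNl (linearN (bracket x)) opprK.
Qed.

Lemma k_aniso x : x \in k -> killing x x = 0 -> x = 0.
Proof.
case: cartan_theta => _ _ pos; rewrite mem_kpart => /eqP tx x0.
by apply/eqP/negPn/negP => /pos; rewrite tx x0 oppr0 ltxx.
Qed.

Lemma p_aniso x : x \in p -> killing x x = 0 -> x = 0.
Proof.
case: cartan_theta => _ _ pos; rewrite mem_ppart => /eqP tx x0.
by apply/eqP/negPn/negP => /pos; rewrite tx linearN /= x0 oppr0 oppr0 ltxx.
Qed.

Lemma kp_cap x : x \in k -> x \in p -> x = 0.
Proof.
rewrite mem_kpart mem_ppart => /eqP -> /eqP xN; apply/eqP.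
have : (2 : R) *: x == 0 by rewrite scaler_nat mulr2n {1}xN addNr.
by rewrite scaler_eq0 pnatr_eq0.
Qed.

Lemma kp_split x : exists y z, [/\ x = y + z, y \in k & z \in p].
Proof.
case: cartan_theta => _ tt _; exists (2^-1 *: (x + theta x)), (2^-1 *: (x - theta x)).
split; first by rewrite -scalerDr addrACA subrr addr0 -mulr2n -(scaler_nat _ x) scalerA mulVf
  ?scale1r ?pnatr_eq0.
  by rewrite mem_kpart linearZ linearD /= tt addrC.
by rewrite mem_ppart linearZ linearB /= tt -scalerN opprB.
Qed.

Lemma maximal_abelian_mem h s x : maximal_abelian_in s h -> x \in s ->
  (forall y, y \in h -> bracket x y = 0) -> x \in h.
Proof.
move=> [hs hab hmax] xs xh; rewrite -(hmax (<[x]> + h)%VS) ?addvSr //.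
- by apply: subvP (addvSl _ _) _ _; exact: memv_line.
- by apply/subvP => y /memv_addP[_ /vlineP[c ->] [z zh ->]]; rewrite rpredD ?rpredZ // (subvP hs).
move=> _ _ /memv_addP[_ /vlineP[c ->] [z zh ->]] /memv_addP[_ /vlineP[c' ->] [z' zh' ->]].
rewrite bracketDl bracketZl !linearD !linearZ /= bracket_alt (xh z') // (hab z z') //.
by rewrite (bracketC z x) xh // oppr0 !scaler0 !addr0.
Qed.

Lemma kp_uniq y y' z z' : y \in k -> y' \in k -> z \in p -> z' \in p ->
  y + z = y' + z' -> y = y' /\ z = z'.
Proof.
move=> yk y'k zp z'p yz.
have E : y - y' = z' - z.
  by apply/eqP; rewrite subr_eq -(inj_eq (addIr z)) yz addrAC subrK addrC.
have yy : y - y' = 0 by apply: kp_cap; [apply: rpredB | rewrite E; apply: rpredB].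
split; first by apply/eqP; rewrite -subr_eq0 yy.
by apply/eqP; rewrite eq_sym -subr_eq0 -E yy.
Qed.

Lemma ad_sq_eq0 y z : bracket y (bracket y z) = 0 ->
  bracket y z \in k \/ bracket y z \in p -> bracket y z = 0.
Proof.
move=> yyz; have yz0 : killing (bracket y z) (bracket y z) = 0.
  set u := bracket y z in yyz *.
  have : killing (bracket z y) u = 0 by rewrite killing_inv yyz linear0.
  by rewrite bracketC -/u killing_sym linearN /= => /eqP; rewrite oppr_eq0 => /eqP.
by case=> [/k_aniso|/p_aniso]; apply.
Qed.

Section MaximalRank.
Context (r : nat) (a : {vspace g}).
Hypothesis a_max : maximal_abelian_in p a.
Hypothesis a_dim : \dim a = r.
Hypothesis rank_r : lie_rank g r.

(* If s is maximal abelian in the centralizer of a in k, then s + a is a Cartan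
   subalgebra of g, so that \dim (s + a) = \dim a. *)
Lemma centralizer_k_eq0 c : c \in k -> (forall y, y \in a -> bracket c y = 0) -> c = 0.
Proof.
move=> ck ca; have [ap aab _] := a_max.
pose Q (s : {vspace g}) := [/\ (s <= k)%VS, abelian_sub s
  & forall y z, y \in s -> z \in a -> bracket y z = 0].
have Qc : Q <[c]>%VS.
  split; first by apply/subvP => _ /vlineP[l ->]; rewrite rpredZ.
    by move=> _ _ /vlineP[l ->] /vlineP[l' ->]; rewrite bracketZl linearZ /= bracket_alt !scaler0.
  by move=> _ z /vlineP[l ->] za; rewrite bracketZl ca ?scaler0.
have [s [cs [sk sab sa] smax]] := exists_maximal_subspace Qc.
have smem z : z \in k -> (forall y, y \in s -> bracket z y = 0) ->
    (forall y, y \in a -> bracket z y = 0) -> z \in s.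
  move=> zk zs za; rewrite -(smax (<[z]> + s)%VS) ?addvSr //.
    by apply: subvP (addvSl _ _) _ _; exact: memv_line.
  split.
  - by apply/subvP => y /memv_addP[_ /vlineP[l ->] [y' ys ->]];
    rewrite rpredD ?rpredZ // (subvP sk).
  - move=> _ _ /memv_addP[_ /vlineP[l ->] [y ys ->]] /memv_addP[_ /vlineP[l' ->] [y' ys' ->]].
    rewrite bracketDl bracketZl !linearD !linearZ /= bracket_alt (zs y') // (sab y y') //.
    by rewrite (bracketC y z) zs // oppr0 !scaler0 !addr0.
  - move=> _ y /memv_addP[_ /vlineP[l ->] [y' ys ->]] ya.
    by rewrite bracketDl bracketZl za // sa // scaler0 addr0.
have hab : abelian_sub (s + a)%VS.
  move=> _ _ /memv_addP[y ys [z za ->]] /memv_addP[y' ys' [z' za' ->]].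
  rewrite bracketDl !linearD /= (sab y y') // (sa y z') // (aab z z') // (bracketC z y') sa //.
  by rewrite oppr0 !addr0.
have cart : cartan_subalgebra (s + a)%VS.
  split.
  - by move=> y z yh zh; rewrite hab // mem0v.
  - exists 1%N => -[|y [|]] //= z _ yh zh; apply: hab => //.
    by apply: yh; rewrite inE.
  move=> x xh; have [u [w [xE uk wp]]] := kp_split x.
  have part_a y : y \in a -> bracket u y \in a /\ bracket w y \in s.
    move=> ya; have yp := subvP ap _ ya.
    have /xh : y \in (s + a)%VS by apply: subvP (addvSr _ _) _ _.
    move=> /memv_addP[y1 ys [y2 ya2]]; rewrite xE bracketDl addrC => E.
    by have [-> ->] := kp_uniq (bracket_pp wp yp) (subvP sk _ ys) (bracket_kp uk yp) (subvP ap
      _ ya2) E.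
  have part_s y : y \in s -> bracket u y \in s /\ bracket w y \in a.
    move=> ys; have yk := subvP sk _ ys.
    have /xh : y \in (s + a)%VS by apply: subvP (addvSl _ _) _ _.
    move=> /memv_addP[y1 ys1 [y2 ya2]]; rewrite xE bracketDl => E.
    have wyp : bracket w y \in p by rewrite bracketC rpredN bracket_kp.
    by have [-> ->] := kp_uniq (bracket_kk uk yk) (subvP sk _ ys1) wyp (subvP ap _ ya2) E.
  have ua y : y \in a -> bracket u y = 0.
    move=> ya; have [uya _] := part_a y ya.
    rewrite bracketC ad_sq_eq0 ?oppr0 //; last by right; rewrite bracketC rpredN (subvP ap).
    by rewrite (bracketC y u) linearN /= aab ?oppr0.
  have wa y : y \in a -> bracket w y = 0.
    move=> ya; have [_ wys] := part_a y ya.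
    rewrite bracketC ad_sq_eq0 ?oppr0 //; last by left; rewrite bracketC rpredN (subvP sk).
    by rewrite (bracketC y w) linearN /= bracketC sa ?oppr0.
  have us y : y \in s -> bracket u y = 0.
    move=> ys; have [uys _] := part_s y ys.
    rewrite bracketC ad_sq_eq0 ?oppr0 //; last by left; rewrite bracketC rpredN (subvP sk).
    by rewrite (bracketC y u) linearN /= sab ?oppr0.
  rewrite xE memv_add //; first exact: smem.
  exact: maximal_abelian_mem a_max wp wa.
have sa_dim : \dim (s + a)%VS = r by case: rank_r => _ ->.
have saE : (s + a)%VS = a by apply/esym/eqP; rewrite eqEdim addvSr a_dim sa_dim /=.
apply: kp_cap => //; apply: (subvP ap); rewrite -saE; apply: (subvP (addvSl _ _)).
by apply: (subvP cs); exact: memv_line.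
Qed.

(* An element y of a for which ad y : k -> p has maximal rank. If [c, y] = 0, then for
   b in a the vector [c, b] is orthogonal to [k, y], and rank_perturb forces it to be 0. *)
Lemma regular_element :
  exists2 y, y \in a & forall c, c \in k -> bracket c y = 0 -> c = 0.
Proof.
have [ap aab _] := a_max.
pose x := vbasis k; pose e := vbasis p.
pose A y : 'M_(\dim k, \dim p) := \matrix_(i, j) coord e j (bracket (tnth x i) y).
have AE (w : 'rV_(\dim k)) y j : (w *m A y) 0 j =
  coord e j (bracket (\sum_i w 0 i *: tnth x i) y).
  by rewrite mxE bracket_suml linear_sum; apply: eq_bigr => i _; rewrite mxE bracketZl linearZ.
have xk (w : 'rV_(\dim k)) : \sum_i w 0 i *: tnth x i \in k.
  by apply: rpred_sum => i _; rewrite rpredZ // (vbasis_mem (mem_tnth _ _)).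
apply: contrapT => noreg.
suff rankA n : exists2 y, y \in a & (n <= \rank (A y))%N.
  by have [y _] := rankA (\dim k).+1; rewrite ltnNge rank_leq_row.
elim: n => [|n [y ya leA]]; first by exists 0; rewrite ?mem0v.
have [c [ck cy c0]] : exists c, [/\ c \in k, bracket c y = 0 & c != 0].
  apply: contrapT => H; apply: noreg; exists y => // c ck cy.
  by apply: contrapT => /eqP c0; apply: H; exists c.
have [b ba cb] : exists2 b, b \in a & bracket c b != 0.
  apply: contrapT => H; case/eqP: c0; apply: centralizer_k_eq0 => // b ba.
  by apply: contrapT => /eqP cb; apply: H; exists b.
pose z : 'rV_(\dim k) := \row_i coord x i c.
have zc : \sum_i z 0 i *: tnth x i = c.
  by rewrite [RHS](coord_vbasis ck); apply: eq_bigr => i _; rewrite mxE -tnth_nth.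
have [||s ltA] := @rank_perturb _ _ _ (A y) (A b) z.
- by apply/rowP => j; rewrite AE zc cy linear0 mxE.
- apply/negP => /submxP[w wE]; case/eqP: cb.
  set c' := \sum_i w 0 i *: tnth x i.
  have c'k : c' \in k by exact: xk.
  have [yp bp] := (subvP ap _ ya, subvP ap _ ba).
  have cbE : bracket c b = bracket c' y.
    rewrite [LHS](coord_vbasis (bracket_kp ck bp)) [RHS](coord_vbasis (bracket_kp c'k yp)).
    apply: eq_bigr => j _; congr (_ *: _).
    by have /rowP/(_ j) := wE; rewrite !AE zc.
  apply: p_aniso; first exact: bracket_kp.
  rewrite {1}cbE killing_inv (_ : bracket y _ = 0) ?linear0 //.
  by rewrite bracketC bracketA (bracketC b) (aab y) // oppr0 linear0 cy linear0 subrr oppr0.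
exists (y + s *: b); first by rewrite rpredD ?rpredZ.
apply: leq_ltn_trans leA _; rewrite (_ : A (y + s *: b) = A y + s *: A b) //.
by apply/matrixP => i j; rewrite !mxE !linearD !linearZ.
Qed.

Lemma dim_kp : (\dim k + r)%N = \dim p.
Proof.
have [ap aab _] := a_max; have [y ya yreg] := regular_element.
have yp := subvP ap _ ya.
pose f : 'End(g) := linfun (bracket y).
have fE z : f z = bracket y z by rewrite lfunE.
have fk : \dim (f @: k) = \dim k.
  apply: limg_dim_eq; apply/eqP; rewrite -subv0; apply/subvP => c.
  rewrite memv_cap memv_ker fE bracketC oppr_eq0 memv0 => /andP[ck /eqP cy].
  by apply/eqP; apply: yreg.
have fa : (f @: k :&: a)%VS = 0%VS.
  apply/eqP; rewrite -subv0; apply/subvP => z; rewrite memv_cap memv0.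
  move=> /andP[/memv_imgP[c ck ->] fca]; rewrite fE in fca *; apply/eqP.
  by apply: ad_sq_eq0; [apply: aab | right; apply: (subvP ap)].
have kerp : (p :&: lker f)%VS = a.
  apply/vspaceP => q; rewrite memv_cap memv_ker fE; apply/andP/idP => [[qp /eqP yq]|qa].
    apply: (maximal_abelian_mem a_max) => // b ba.
    have bp := subvP ap _ ba.
    apply: yreg; first exact: bracket_pp.
    by rewrite bracketA (bracketC q y) yq (aab b y) // oppr0 !linear0 addr0.
  by rewrite (subvP ap) // aab.
have le1 : (\dim k + r <= \dim p)%N.
  rewrite -fk -a_dim -(dimv_disjoint_sum fa); apply: dimvS; rewrite subv_add ap andbT.
  apply/subvP => _ /memv_imgP[c ck ->]; rewrite fE bracketC rpredN; exact: bracket_kp.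
have : (\dim p <= r + \dim k)%N.
  rewrite -(limg_ker_dim f p) kerp a_dim leq_add2l; apply: dimvS.
  by apply/subvP => _ /memv_imgP[q qp ->]; rewrite fE bracket_pp.
lia.
Qed.

End MaximalRank.
End CartanInvolution.

(** * Root vectors of the complexified isotropy algebra *)

Section Complexify.
Context (R : realType) (g : lieAlgebra R) (theta : 'End(g)).
Context (m d : nat) (x : m.-tuple g) (e : d.-tuple g).
Hypothesis cartan_theta : cartan_involution theta.
Hypothesis x_orth : orthonormal_basis_k theta x.
Hypothesis e_orth : orthonormal_basis_p theta e.
Local Notation C := R[i].
Local Notation rc := (real_complex R).
Local Notation k := (kpart theta).
Local Notation p := (ppart theta).
Local Notation conjmx := (map_mx (@Num.conj C)).
Local Notation cvec := (cvec x).
Implicit Types (y : g) (z h : 'rV[C]_m).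

Lemma conj_rc (a : R) : Num.conj (rc a) = rc a.
Proof. exact: conjc_real. Qed.

Lemma conj_map_rc n1 n2 (M : 'M[R]_(n1, n2)) : conjmx (map_mx rc M) = map_mx rc M.
Proof. by apply/matrixP => i j; rewrite !mxE conj_rc. Qed.

Section AnyBasis.
Context (n : nat) (b : n.-tuple g).

Lemma adc_linear : linear (adc x b).
Proof.
move=> c z z'; rewrite /adc scaler_sumr -big_split /=; apply: eq_bigr => i _.
by rewrite !mxE scalerDl scalerA.
Qed.
HB.instance Definition _ := GRing.isLinear.Build C 'rV[C]_m 'M[C]_n *:%R (adc x b) adc_linear.

Lemma conj_adc z : conjmx (adc x b z) = adc x b (conjmx z).
Proof.
rewrite /adc raddf_sum; apply: eq_bigr => i _ /=.
by rewrite map_mxZ conj_map_rc mxE.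
Qed.

Lemma ad_mx_linear : linear (@ad_mx R g n b).
Proof. by move=> c y y'; apply/matrixP => i j; rewrite !mxE bracketDl bracketZl linearP. Qed.
HB.instance Definition _ := GRing.isLinear.Build R g 'M[R]_n *:%R (@ad_mx R g n b) ad_mx_linear.

Lemma adc_cvec y : y \in k -> adc x b (cvec y) = map_mx rc (ad_mx b y).
Proof.
have [[xb _]] := x_orth => yk; rewrite {2}(coord_basis xb yk) linear_sum raddf_sum.
by apply: eq_bigr => i _; rewrite linearZ /= map_mxZ mxE -tnth_nth.
Qed.
End AnyBasis.

Lemma tnth_xk i : tnth x i \in k.
Proof. by have [[xb _]] := x_orth; rewrite (basis_mem xb) // mem_tnth. Qed.

Lemma tnth_ep i : tnth e i \in p.
Proof. by have [[eb _]] := e_orth; rewrite (basis_mem eb) // mem_tnth. Qed.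

Lemma coord_x y i : y \in k -> coord x i y = - killing y (tnth x i).
Proof.
have [[xb xo]] := x_orth => yk;
  rewrite {2}(coord_basis xb yk) killing_sym (linear_sum (killing _)) -sumrN /=.
rewrite (bigD1 i) //= killingZ -tnth_nth -mulrN xo eqxx mulr1 big1 ?addr0 // => j /negPf ji.
by rewrite killingZ -tnth_nth -mulrN xo eq_sym ji mulr0.
Qed.

Lemma coord_e y i : y \in p -> coord e i y = killing y (tnth e i).
Proof.
have [[eb eo]] := e_orth => yp; rewrite {2}(coord_basis eb yp) killing_sym linear_sum /=.
rewrite (bigD1 i) //= killingZ -tnth_nth eo eqxx mulr1 big1 ?addr0 // => j /negPf ji.
by rewrite killingZ -tnth_nth eo eq_sym ji mulr0.
Qed.

Lemma ad_mx_x_skew y : y \in k -> (ad_mx x y)^T = - ad_mx x y.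
Proof.
move=> yk; apply/matrixP => i j; rewrite !mxE !coord_x ?(bracket_kk cartan_theta) ?tnth_xk //.
by rewrite (bracketC y) killing_sym linearN /= killing_sym killing_inv (killing_sym (bracket y
  _)).
Qed.

Lemma ad_mx_e_skew y : y \in k -> (ad_mx e y)^T = - ad_mx e y.
Proof.
move=> yk; apply/matrixP => i j;
  rewrite !mxE !coord_e ?(bracket_kp cartan_theta) ?tnth_xk ?tnth_ep //.
by rewrite (bracketC y) killing_sym linearN /= killing_sym killing_inv (killing_sym (bracket y
  _)).
Qed.

Lemma adc_adjoint n (b : n.-tuple g) :
  (forall y, y \in k -> (ad_mx b y)^T = - ad_mx b y) ->
  forall z, conjmx (adc x b z)^T = - adc x b (conjmx z).
Proof.
move=> skew z; rewrite -map_trmx conj_adc /adc raddf_sum -sumrN; apply: eq_bigr => i _ /=.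
by rewrite linearZ /= map_trmx skew ?tnth_xk // map_mxN scalerN.
Qed.

Definition adc_x_adjoint := adc_adjoint ad_mx_x_skew.
Definition adc_e_adjoint := adc_adjoint ad_mx_e_skew.

Lemma adc_bracket n (b : n.-tuple g) :
  (forall y i, y \in k -> bracket y (tnth b i) \in <<b>>%VS) ->
  forall h z, adc x b (cbracket x h z) = adc x b z *m adc x b h - adc x b h *m adc x b z.
Proof.
move=> bb h z; rewrite /cbracket.
have xx i j : adc x b (row j (map_mx rc (ad_mx x (tnth x i)))) =
    map_mx rc (ad_mx b (tnth x j)) *m map_mx rc (ad_mx b (tnth x i))
    - map_mx rc (ad_mx b (tnth x i)) *m map_mx rc (ad_mx b (tnth x j)).
  have -> : row j (map_mx rc (ad_mx x (tnth x i))) = cvec (bracket (tnth x i) (tnth x j)).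
    by apply/rowP => l; rewrite !mxE.
  rewrite adc_cvec ?(bracket_kk cartan_theta) ?tnth_xk // ad_mx_bracket.
  - by rewrite map_mxB !map_mxM.
  - by move=> l; rewrite bb ?tnth_xk.
  - by move=> l; rewrite bb ?tnth_xk.
rewrite mulmx_sum_row linear_sum /=.
transitivity (\sum_j \sum_i (z 0 j * h 0 i) *: adc x b (row j (map_mx rc (ad_mx x (tnth x i))))).
  apply: eq_bigr => j _; rewrite linearZ /=.
  have -> : row j (adc x x h) = \sum_i h 0 i *: row j (map_mx rc (ad_mx x (tnth x i))).
    by rewrite /adc raddf_sum; apply: eq_bigr => i _ /=; rewrite linearZ.
  by rewrite (linear_sum (adc x b)) scaler_sumr; apply: eq_bigr => i _; rewrite linearZ scalerA.
rewrite [adc x b z]/adc mulmx_suml mulmx_sumr -sumrB; apply: eq_bigr => j _.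
rewrite [adc x b h]/adc mulmx_sumr mulmx_suml -sumrB; apply: eq_bigr => i _.
by rewrite xx scalerBr -!scalemxAl -!scalemxAr !scalerA (mulrC (h 0 i)).
Qed.

Lemma adc_x_bracket h z :
  adc x x (cbracket x h z) = adc x x z *m adc x x h - adc x x h *m adc x x z.
Proof.
apply: adc_bracket => y i yk; have [[xb _]] := x_orth.
by rewrite (span_basis xb) (bracket_kk cartan_theta) ?tnth_xk.
Qed.

Lemma adc_e_bracket h z :
  adc x e (cbracket x h z) = adc x e z *m adc x e h - adc x e h *m adc x e z.
Proof.
apply: adc_bracket => y i yk; have [[eb _]] := e_orth.
by rewrite (span_basis eb) (bracket_kp cartan_theta) ?tnth_ep.
Qed.

Lemma ext_act_cbracket h z a :
  ext_act (adc x e (cbracket x h z)) a =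
  ext_act (adc x e h) (ext_act (adc x e z) a) - ext_act (adc x e z) (ext_act (adc x e h) a).
Proof. by rewrite ext_act_comm adc_e_bracket. Qed.

Lemma cbracket_cvec y y' : y \in k -> y' \in k ->
  cbracket x (cvec y) (cvec y') = cvec (bracket y y').
Proof.
move=> yk y'k; have [[xb _]] := x_orth; rewrite /cbracket adc_cvec //.
apply/rowP => j; rewrite !mxE {2}(coord_basis xb y'k) !linear_sum raddf_sum.
by apply: eq_bigr => i _; rewrite !mxE linearZ /= linearZ rmorphM -tnth_nth.
Qed.

Definition re_k z : g := \sum_i complex.Re (z 0 i) *: tnth x i.
Definition im_k z : g := \sum_i complex.Im (z 0 i) *: tnth x i.

Lemma sum_xk (c : 'I_m -> R) : \sum_i c i *: tnth x i \in k.
Proof. by apply: rpred_sum => i _; rewrite rpredZ ?tnth_xk. Qed.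

Lemma coord_sum_x (c : 'I_m -> R) i : coord x i (\sum_j c j *: tnth x j) = c i.
Proof.
have [[xb _]] := x_orth; rewrite linear_sum (bigD1 i) //= linearZ /= (tnth_nth 0).
rewrite coord_free ?(basis_free xb) // eqxx mulr1 big1 ?addr0 // => j /negPf ji.
by rewrite linearZ /= (tnth_nth 0) coord_free ?(basis_free xb) // ji mulr0.
Qed.

Lemma re_imE z : z = cvec (re_k z) + 'i *: cvec (im_k z).
Proof. by apply/rowP => i; rewrite !mxE !coord_sum_x; apply: complexE. Qed.

Lemma cvec_reim_eq0 y y' : y \in k -> y' \in k ->
  cvec y + 'i *: cvec y' = 0 -> y = 0 /\ y' = 0.
Proof.
have [[xb _]] := x_orth => yk y'k /rowP E.
have {}E i : coord x i y = 0 /\ coord x i y' = 0.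
  by have := E i; rewrite !mxE; simpc; case=> -> ->.
split; first by rewrite (coord_basis xb yk) big1 // => i _; rewrite (E i).1 scale0r.
by rewrite (coord_basis xb y'k) big1 // => i _; rewrite (E i).2 scale0r.
Qed.

Section Roots.
Context (t : {vspace g}) (P : {scalar 'rV[C]_m} -> Prop) (b : {vspace 'rV[C]_m}).
Hypothesis t_max : maximal_abelian_in k t.
Hypothesis P_pos : positive_system x t P.
Hypothesis b_borel : borel_subalgebra x t P b.

Lemma cvec_additive : {morph cvec : y y' / y + y'}.
Proof. by move=> y y'; apply/rowP => i; rewrite !mxE linearD rmorphD. Qed.

Lemma cvec_scale a y : cvec (a *: y) = rc a *: cvec y.
Proof. by apply/rowP => i; rewrite !mxE linearZ rmorphM. Qed.

Lemma cvec_sum n (E : 'I_n -> g) : cvec (\sum_i E i) = \sum_i cvec (E i).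
Proof.
apply: (big_morph cvec cvec_additive).
by apply/rowP => i; rewrite !mxE linear0 rmorph0.
Qed.

Lemma csub_cvec y : y \in t -> cvec y \in csub x t.
Proof.
move=> yt; rewrite (coord_vbasis yt) cvec_sum; apply: rpred_sum => i _.
rewrite cvec_scale rpredZ //; apply/memv_span/map_f.
by rewrite mem_nth // size_tuple.
Qed.

Lemma csub_ind (Q : 'rV[C]_m -> Prop) : Q 0 ->
  (forall c z h, Q z -> Q h -> Q (c *: z + h)) ->
  (forall y, y \in t -> Q (cvec y)) -> forall h, h \in csub x t -> Q h.
Proof.
move=> Q0 Ql Qt h; rewrite /csub -[s in <<s>>%VS]/(tval (in_tuple [seq cvec y | y <- vbasis t])).
move=> /coord_span ->; elim/big_rec: _ => // i z _; apply: Ql.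
have : (in_tuple [seq cvec y | y <- vbasis t])`_i \in [seq cvec y | y <- vbasis t] by rewrite
  mem_nth.
by case/mapP => y yt ->; apply/Qt/vbasis_mem.
Qed.

Lemma csub_conj h : h \in csub x t -> conjmx h \in csub x t.
Proof.
move: h; apply: csub_ind => [|c z h zt ht|y yt]; first by rewrite map_mx0 mem0v.
  by rewrite map_mxD map_mxZ rpredD ?rpredZ.
rewrite (_ : conjmx _ = cvec y) ?csub_cvec //.
by apply/rowP => i; rewrite !mxE conj_rc.
Qed.

Definition root_form z (phi : 'cV[C]_m) h : C := (cbracket x h z *m phi) 0 0.

Lemma root_form_linear z phi : linear_for *%R (root_form z phi).
Proof.
move=> c h h'; rewrite /root_form /cbracket linearP mulmxDr -scalemxAr mulmxDl -scalemxAl.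
by rewrite !mxE.
Qed.
HB.instance Definition _ z phi :=
  GRing.isLinear.Build C 'rV[C]_m C *%R (root_form z phi) (root_form_linear z phi).

Lemma conj_cbracket h z : conjmx (cbracket x h z) = cbracket x (conjmx h) (conjmx z).
Proof. by rewrite /cbracket map_mxM conj_adc. Qed.

Lemma map_conjK n1 n2 (M : 'M[C]_(n1, n2)) : conjmx (conjmx M) = M.
Proof. by apply/matrixP => i j; rewrite !mxE conjCK. Qed.

(* k^c = b + conj(n): the commuting normal operators ad h, h in t, have a common
   eigenbasis, and an eigenvector is in t^c, a positive root vector, or the conjugate
   of a positive root vector. *)
Lemma borel_triangular (Y : {vspace 'rV[C]_m}) : (b <= Y)%VS ->
  (forall alpha z, P alpha -> root_vector x t alpha z -> conjmx z \in Y) ->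
  Y = fullv.
Proof.
move=> bY nY; have [[tb Pb] _] := b_borel; have [tk tab _] := t_max.
have [h0 h0t [h0reg PP]] := P_pos.
pose As := [seq adc x x (cvec y) | y <- vbasis t].
have tbk y : y \in tval (vbasis t) -> y \in k by move=> /vbasis_mem /(subvP tk).
have [Q Qu QA] : codiagonalizable As.
  apply/codiagonalizableP; split=> [_ _ /mapP[y yt ->] /mapP[y' yt' ->]|_ /mapP[y yt ->]].
    apply/eqP; rewrite -subr_eq0 -adc_x_bracket cbracket_cvec ?tbk //.
    rewrite tab ?vbasis_mem // (_ : cvec 0 = 0) ?linear0 //.
    by apply/rowP => i; rewrite !mxE linear0 rmorph0.
  have An : adc x x (cvec y) \is normalmx.
    apply/normalmxP; rewrite adc_x_adjoint (_ : conjmx _ = cvec y) ?mulmxN ?mulNmx //.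
    by apply/rowP => i; rewrite !mxE conj_rc.
  exists (spectralmx (adc x x (cvec y))); first exact: spectral_unit.
  apply/diagonalizable_forPex; exists (spectral_diag (adc x x (cvec y))).
  apply/simmxP; first exact: spectral_unit.
  by rewrite {2}(orthomx_spectralP An) !mulmxA mulmxV ?spectral_unit // mul1mx.
have eig i h : h \in csub x t -> exists c, cbracket x h (row i Q) = c *: row i Q.
  rewrite /csub -[s in <<s>>%VS]/(tval (in_tuple [seq cvec y | y <- vbasis t])).
  move=> /coord_span ->; elim/big_rec: _ => [|j z _ [c IH]].
    by exists 0; rewrite /cbracket linear0 mulmx0 scale0r.
  have : (in_tuple [seq cvec y | y <- vbasis t])`_j \in [seq cvec y | y <- vbasis t] by rewrite
    mem_nth.
  case/mapP => y yt ->; have /(allP QA)/= : adc x x (cvec y) \in As by apply: map_f.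
  move=> /diagonalizable_forPex[D /(simmxP Qu) QD].
  rewrite /cbracket linearP mulmxDr -scalemxAr -[_ *m adc x x z]/(cbracket x z _) IH.
  rewrite -row_mul QD row_mul row_diag_mx -scalemxAl -rowE scalerA -scalerDl.
  by eexists.
have form i h : h \in csub x t ->
    cbracket x h (row i Q) = root_form (row i Q) (col i (invmx Q)) h *: row i Q.
  move=> /(eig i) [c hq]; rewrite /root_form hq -scalemxAl; congr (_ *: _).
  have -> : row i Q *m col i (invmx Q) = 1%:M.
    rewrite colE mulmxA -row_mul mulmxV // row1; apply/matrixP => j j'.
    by rewrite !ord1 mxE (bigD1 i) //= !mxE !eqxx mulr1 big1 ?addr0 // => l /negPf li;
      rewrite !mxE li mulr0.
  by rewrite !mxE eqxx mulr1.
have form_conj i h : h \in csub x t -> cbracket x h (conjmx (row i Q)) =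
    root_form (conjmx (row i Q)) (conjmx (col i (invmx Q))) h *: conjmx (row i Q).
  move=> ht; have := form i _ (csub_conj ht) => /(congr1 conjmx).
  rewrite conj_cbracket map_conjK map_mxZ => ->; congr (_ *: _).
  by rewrite /root_form -{2}(map_conjK h) -conj_cbracket -map_mxM [RHS]mxE.
have conj_form i y : root_form (conjmx (row i Q)) (conjmx (col i (invmx Q))) (cvec y) =
    Num.conj (root_form (row i Q) (col i (invmx Q)) (cvec y)).
  have yE : conjmx (cvec y) = cvec y by apply/rowP => j; rewrite !mxE conj_rc.
  by rewrite /root_form -{1}yE -conj_cbracket -map_mxM mxE.
have rowQ0 i : row i Q != 0.
  apply/eqP => q0; have /rowP/(_ i) : row i (1%:M : 'M[C]_m) = 0.
    by rewrite -(mulmxV Qu) row_mul q0 mul0mx.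
  by rewrite !mxE eqxx => /eqP; rewrite oner_eq0.
have rowQ i : row i Q \in Y.
  pose al : {scalar 'rV[C]_m} := root_form (row i Q) (col i (invmx Q)).
  have [[h ht ah]|al0] := pselect (exists2 h, h \in csub x t & al h != 0); last first.
    pose q := row i Q; have q0 y : y \in t -> bracket y (re_k q) = 0 /\ bracket y (im_k q) = 0.
      move=> yt; have yk := subvP tk _ yt.
      apply: cvec_reim_eq0; rewrite ?(bracket_kk cartan_theta) ?sum_xk //.
      rewrite -!cbracket_cvec ?sum_xk // /cbracket scalemxAl -mulmxDl -re_imE.
      rewrite -[LHS]/(cbracket x (cvec y) (row i Q)) form ?csub_cvec //.
      rewrite (_ : root_form _ _ _ = 0) ?scale0r //; apply: contrapT => /eqP ay.
      by apply: al0; exists (cvec y); rewrite ?csub_cvec.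
    have ret : re_k q \in t.
      by apply: (maximal_abelian_mem t_max); rewrite ?sum_xk // => y /q0[+ _];
        rewrite (bracketC _ y) => ->; rewrite oppr0.
    have imt : im_k q \in t.
      by apply: (maximal_abelian_mem t_max); rewrite ?sum_xk // => y /q0[_];
        rewrite (bracketC _ y) => ->; rewrite oppr0.
    rewrite [row i Q]re_imE; apply: (subvP bY); apply: (subvP tb).
    by rewrite rpredD ?rpredZ ?csub_cvec.
  have al_root : is_root x t al.
    by split; [exists h | exists (row i Q) => // h' h't; apply: form].
  have := h0reg _ al_root; rewrite neq_lt => /orP[neg|pos]; last first.
    apply: (subvP bY); apply: (Pb al); first by apply/PP.
    by move=> h' h't; apply: form.
  pose al' : {scalar 'rV[C]_m} := root_form (conjmx (row i Q)) (conjmx (col i (invmx Q))).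
  have pos : 0 < complex.Im (al' (cvec h0)).
    by rewrite /al' /= conj_form; move: neg; rewrite /al /=; case: (root_form _ _ _) => u w /=;
      rewrite oppr_gt0.
  rewrite -[row i Q]map_conjK; apply: (nY al'); last by move=> h' h't; apply: form_conj.
  apply/PP; split=> //; split; first by exists (cvec h0); rewrite ?csub_cvec //;
    apply: contraTneq pos => ->; rewrite ltxx.
  exists (conjmx (row i Q)); last by move=> h' h't; apply: form_conj.
  by apply: contra_neq (rowQ0 i) => q0; rewrite -[row i Q]map_conjK q0 map_mx0.
apply/vspaceP => z; rewrite memvf -[z](mulmxKV Qu) mulmx_sum_row.
by apply: rpred_sum => i _; rewrite rpredZ.
Qed.
End Roots.

End Complexify.

(** * The module generated by a highest weight vector *)

Section HermitianForm.
Context (R : realType) (d : nat).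
Local Notation C := R[i].
Local Notation conjmx := (map_mx (@Num.conj C)).
Implicit Types (a b : ext C d) (U : {vspace ext C d}).

Definition hermdot a b : C := \sum_(S : {set 'I_d}) (a S : C) * Num.conj (b S : C).

Lemma hermdot_linear b : linear_for *%R (hermdot^~ b).
Proof.
move=> c a a'; rewrite /hermdot mulr_sumr -big_split; apply: eq_bigr => S _ /=.
by rewrite !ffunE /GRing.scale /= mulrDl mulrA.
Qed.

Definition hermdotr b a := hermdot a b.
HB.instance Definition _ b := GRing.isLinear.Build C (ext C d) C *%R (hermdotr b)
  (hermdot_linear b).

Lemma hermdotC a b : hermdot a b = Num.conj (hermdot b a).
Proof.
by rewrite /hermdot rmorph_sum; apply: eq_bigr => S _ /=; rewrite rmorphM /= conjCK mulrC.
Qed.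

Lemma hermdotPl c a a' b : hermdot (c *: a + a') b = c * hermdot a b + hermdot a' b.
Proof. exact: hermdot_linear. Qed.

Lemma hermdot0l b : hermdot 0 b = 0.
Proof. exact: (linear0 (hermdotr b)). Qed.

Lemma hermdotNr a b : hermdot a (- b) = - hermdot a b.
Proof. by rewrite hermdotC -[hermdot _ _]/(hermdotr _ _) linearN rmorphN /= -hermdotC. Qed.

Lemma hermdot0r b : hermdot b 0 = 0.
Proof. by rewrite hermdotC hermdot0l rmorph0. Qed.

Lemma hermdot_eq0 a : hermdot a a = 0 -> a = 0.
Proof.
move=> a0; apply/ffunP => S; rewrite ffunE; apply/eqP; rewrite -normr_eq0 -sqrf_eq0 normCK.
have := a0 => /psumr_eq0P -> // T _; exact: mul_conjC_ge0.
Qed.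

Lemma hermdot_creation j a b : hermdot (creation j a) b = hermdot a (annihilation j b).
Proof.
rewrite /hermdot (bigID (fun S : {set 'I_d} => j \in S)) /= [X in _ + X]big1 ?addr0; last first.
  by move=> S /negPf jS; rewrite ffunE jS mul0r.
rewrite [RHS](bigID (fun S : {set 'I_d} => j \in S)) /= [X in _ = X + _]big1 ?add0r; last first.
  by move=> S jS; rewrite ffunE jS rmorph0 mulr0.
rewrite (reindex_onto (fun T : {set 'I_d} => j |: T) (fun T : {set 'I_d} => T :\ j)) /=;
  last first.
  by move=> T jT; rewrite setD1K.
apply: eq_big => [T|T].
  rewrite setU11 /=; apply/eqP/idP => [<-|/setU1K//]; by rewrite !inE eqxx.
rewrite setU11 => /= /eqP jT; have jnT : j \notin T by rewrite -jT !inE eqxx.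
by rewrite !ffunE setU11 (negPf jnT) jT nbelowU1_id rmorphM rmorphXn rmorphN1; ring.
Qed.

Lemma hermdot_annihilation j a b : hermdot (annihilation j a) b = hermdot a (creation j b).
Proof. by rewrite hermdotC -hermdot_creation -hermdotC. Qed.

Lemma ext_act_sumE (M : 'M[C]_d) a :
  ext_act M a = \sum_(q : 'I_d * 'I_d) M q.1 q.2 *: creation q.2 (annihilation q.1 a).
Proof.
rewrite ext_actE -(pair_big predT predT (fun i j => M i j *: creation j (annihilation i a))).
by apply: eq_bigr => i _; rewrite ext_mul_vecE; apply: eq_bigr => j _; rewrite mxE.
Qed.

Lemma hermdot_act M a b : hermdot (ext_act M a) b = hermdot a (ext_act (conjmx M^T) b).
Proof.
rewrite !ext_act_sumE -[LHS]/(hermdotr b _) linear_sum hermdotC -[X in Num.conj X]/(hermdotr a _).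
rewrite (linear_sum (hermdotr a)) rmorph_sum.
rewrite (reindex_inj (_ : injective (fun q : 'I_d * 'I_d => (q.2, q.1)))) /=;
  last by case=> ? ? [? ?] [-> ->].
apply: eq_bigr => -[i j] _ /=.
rewrite !linearZ /= /hermdotr rmorphM /= !mxE.
by congr (_ * _); [exact/esym/conjCK | rewrite hermdot_creation hermdot_annihilation;
  exact: hermdotC].
Qed.

Lemma orthogonal_projection U a :
  exists2 a1, a1 \in U & forall u, u \in U -> hermdot (a - a1) u = 0.
Proof.
pose L a : 'rV[C]_(\dim U) := \row_i hermdot a (tnth (vbasis U) i).
have Llin : linear L.
  by move=> c a1 a2; apply/rowP => i; rewrite !mxE hermdotPl.
pose Llin' := GRing.isLinear.Build C (ext C d) 'rV[C]_(\dim U) *:%R L Llin.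
pose LL : {linear ext C d -> 'rV[C]_(\dim U)} := HB.pack L Llin'.
pose f := linfun LL.
have fE a1 i : f a1 0 i = hermdot a1 (tnth (vbasis U) i) by rewrite lfunE mxE.
have orth a1 : (forall i, hermdot a1 (tnth (vbasis U) i) = 0) -> forall u, u \in U ->
  hermdot a1 u = 0.
  move=> H u /coord_vbasis ->; rewrite hermdotC -[hermdot _ _]/(hermdotr _ _) linear_sum big1
    ?rmorph0 // => i _.
  by rewrite linearZ /= /hermdotr hermdotC -tnth_nth H rmorph0 mulr0.
have dimf : \dim (f @: U) = \dim U.
  apply: limg_dim_eq; apply/eqP; rewrite -subv0; apply/subvP => u.
  rewrite memv_cap memv_ker memv0 => /andP[uU /eqP fu]; apply/eqP.
  by apply: hermdot_eq0; apply: orth => // i; rewrite -fE fu mxE.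
have ff : (f @: U)%VS = fullv.
  by apply/eqP; rewrite eqEdim subvf dimf dimvf /dim /= mul1n.
have : f a \in (f @: U)%VS by rewrite ff memvf.
case/memv_imgP => a1 a1U fa; exists a1 => //; apply: orth => i.
by rewrite -[hermdot _ _]/(hermdotr _ _) linearB /= /hermdotr -!fE fa subrr.
Qed.

End HermitianForm.

Section HighestWeight.
Context (R : realType) (g : lieAlgebra R) (theta : 'End(g)).
Context (m d r : nat) (x : m.-tuple g) (e : d.-tuple g).
Context (t : {vspace g}) (P : {scalar 'rV[R[i]]_m} -> Prop).
Context (b : {vspace 'rV[R[i]]_m}) (v : {vspace 'rV[R[i]]_d}).
Context (u : r.-tuple 'rV[R[i]]_d).
Local Notation C := R[i].
Local Notation conjmx := (map_mx (@Num.conj C)).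
Hypothesis cartan_theta : cartan_involution theta.
Hypothesis x_orth : orthonormal_basis_k theta x.
Hypothesis e_orth : orthonormal_basis_p theta e.
Hypothesis t_max : maximal_abelian_in (kpart theta) t.
Hypothesis P_pos : positive_system x t P.
Hypothesis b_borel : borel_subalgebra x t P b.
Hypothesis v_stable : stable_under x e b v.
Hypothesis u_basis : basis_of v u.
Implicit Types (a : ext C d) (z h : 'rV[C]_m) (U : {vspace ext C d}).
Local Notation w := (wedge u).
Local Notation act z := (ext_act (adc x e z)).

Lemma wedge_basis_neq0 : w != 0.
Proof. exact/wedge_neq0/(basis_free u_basis). Qed.

Lemma borel_eigenvector z : z \in b -> exists c, act z w = c *: w.
Proof.
move=> zb; apply: ext_act_wedge_stable => y yu.
rewrite (span_basis u_basis); apply: (v_stable zb).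
by rewrite -(span_basis u_basis); apply: memv_span.
Qed.

Definition act_on a z : ext C d := act z a.
Lemma act_on_linear a : linear (act_on a).
Proof. by move=> c z z'; rewrite /act_on linearP ext_act_mxP. Qed.
HB.instance Definition _ a :=
  GRing.isLinear.Build C 'rV[C]_m (ext C d) *:%R (act_on a) (act_on_linear a).

Lemma actZ c z a : act (c *: z) a = c *: act z a.
Proof. by rewrite linearZ ext_act_mxZ. Qed.

Lemma act_root_vector alpha z : P alpha -> root_vector x t alpha z -> act z w = 0.
Proof.
move=> Pal zal; have [[tb Pb] _] := b_borel; have [h0 _ [_ PP]] := P_pos.
have [[[h ht ah] _] _] := (PP alpha).1 Pal.
have [c hw] := borel_eigenvector (subvP tb _ ht);
  have [c' zw] := borel_eigenvector (Pb _ _ Pal zal).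
have := ext_act_cbracket cartan_theta x_orth e_orth h z w.
rewrite (zal h ht) actZ hw zw !ext_actZ hw zw !scalerA (mulrC c) subrr => /eqP.
by rewrite scaler_eq0 (negPf wedge_basis_neq0) orbF mulf_eq0 (negPf ah) => /eqP c0;
  rewrite c0 scale0r.
Qed.

Lemma wedge_highest_weight : highest_weight_vector x e t P w.
Proof.
have [[tb _] _] := b_borel; split; [exact: wedge_basis_neq0 | | exact: act_root_vector].
have [S wS] : exists S, w S != 0.
  apply: contrapT => H; case/eqP: wedge_basis_neq0; apply/ffunP => S; rewrite ffunE.
  by apply: contrapT => /eqP wS; apply: H; exists S.
pose lam h : C := (act h w S : C) / (w S : C).
have lamlin : linear_for *%R lam.
  move=> c h h'; rewrite /lam -[act _ w]/(act_on w _) linearP /= /act_on !ffunE /GRing.scale /=.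
  by rewrite mulrDl mulrA.
pose lamL := GRing.isLinear.Build C 'rV[C]_m C *%R lam lamlin.
pose lamS : {scalar 'rV[C]_m} := HB.pack lam lamL.
exists lamS => h /(subvP tb)/borel_eigenvector[c hw]; rewrite hw; congr (_ *: _).
by rewrite /= /lam hw ffunE /GRing.scale /= mulfK.
Qed.

Let N z := exists2 alpha, P alpha & root_vector x t alpha (conjmx z).

Inductive cyclic : ext C d -> Prop :=
| cyclic_w : cyclic w
| cyclicP c a a' : cyclic a -> cyclic a' -> cyclic (c *: a + a')
| cyclicN z a : N z -> cyclic a -> cyclic (act z a).

Lemma cyclic0 : cyclic 0.
Proof. by have := cyclicP (-1) cyclic_w cyclic_w; rewrite scaleN1r addNr. Qed.

Lemma cyclicZ c a : cyclic a -> cyclic (c *: a).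
Proof. by move=> ca; rewrite -[_ *: _]addr0; apply: cyclicP => //; apply: cyclic0. Qed.

Lemma cyclicD a a' : cyclic a -> cyclic a' -> cyclic (a + a').
Proof. by move=> ca ca'; rewrite -[a]scale1r; apply: cyclicP. Qed.

Lemma cyclic_act_of_b a : cyclic a -> (forall z, z \in b -> cyclic (act z a)) ->
  forall z, cyclic (act z a).
Proof.
move=> ca ba.
have [Y YE] := @predicate_subspace _ _ (fun z => cyclic (act z a))
  (eq_ind_r cyclic cyclic0 (linear0 (act_on a)))
  (fun c z z' cz cz' => eq_ind_r cyclic (cyclicP c cz cz') (act_on_linear a c z z')).
have YT : Y = fullv.
  apply: (borel_triangular cartan_theta x_orth t_max P_pos b_borel).
    by apply/subvP => z zb; apply/YE; apply: ba.
  move=> alpha z Pal zal; apply/YE; apply: cyclicN => //; exists alpha => //.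
  by rewrite map_conjK.
by move=> z; apply/YE; rewrite YT memvf.
Qed.

Lemma cyclic_b a : cyclic a -> forall z, z \in b -> cyclic (act z a).
Proof.
elim=> {a} [z zb|c a a' ca IHa ca' IHa' z zb|n a Nn ca IHa z zb].
- by have [c ->] := borel_eigenvector zb; apply/cyclicZ/cyclic_w.
- by rewrite linearP; apply: cyclicP; [apply: IHa | apply: IHa'].
have -> : act z (act n a) = act (cbracket x z n) a + act n (act z a).
  by rewrite (ext_act_cbracket cartan_theta x_orth e_orth) subrK.
apply: cyclicD; first exact: cyclic_act_of_b.
by apply: cyclicN => //; apply: IHa.
Qed.

Lemma cyclic_act a z : cyclic a -> cyclic (act z a).
Proof. by move=> ca; apply: cyclic_act_of_b => //; apply: cyclic_b. Qed.

Lemma hermdot_act_conj z a a' : hermdot (act z a) a' = - hermdot a (act (conjmx z) a').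
Proof.
rewrite hermdot_act (adc_e_adjoint cartan_theta x_orth e_orth).
by rewrite ext_act_mxN hermdotNr.
Qed.

Definition n_killed a := forall z, N z -> act (conjmx z) a = 0.

Lemma n_killed_w : n_killed w.
Proof. by move=> z [alpha Pal zal]; apply: act_root_vector zal. Qed.

Lemma cyclic_n_killed a : cyclic a ->
  exists c, forall a', n_killed a' -> hermdot a a' = c * hermdot w a'.
Proof.
elim=> {a} [|c a a' _ [c1 IH1] _ [c2 IH2]|z a Nz _ _].
- by exists 1 => a' _; rewrite mul1r.
- by exists (c * c1 + c2) => a2 ka2; rewrite hermdotPl IH1 // IH2 // mulrDl mulrA.
- by exists 0 => a2 ka2; rewrite mul0r hermdot_act_conj ka2 // hermdot0r oppr0.
Qed.

Lemma cyclic_irreducible : exists2 W : {vspace ext C d},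
  irreducible_component x e r W & w \in W.
Proof.
have [W WE] := predicate_subspace cyclic0 (fun c a a' => @cyclicP c a a').
exists W; last exact/WE/cyclic_w.
split.
- move=> a /WE; elim=> {a} [|c a a' _ da _ da'|z a _ _ da].
  + by have := ext_degree_wedge (us := u); rewrite size_tuple.
  + exact: ext_degreeP.
  + exact: ext_degree_act.
- by move=> z a /WE ca; apply/WE/cyclic_act.
- apply/eqP => W0; have /WE := cyclic_w; rewrite W0 memv0; apply/negP; exact: wedge_basis_neq0.
move=> U UW Usub; have [w1 w1U w2U] := orthogonal_projection U w.
have w1k : n_killed w1.
  move=> z Nz; apply: hermdot_eq0.
  have E : act (conjmx z) w1 = - act (conjmx z) (w - w1).
    by rewrite linearB /= n_killed_w // sub0r opprK.
  rewrite {2}E hermdotNr hermdotC hermdot_act_conj w2U ?oppr0 ?rmorph0 ?oppr0 //.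
  by apply: (Usub); apply: (Usub).
have [c cE] := cyclic_n_killed ((WE w1).1 (subvP UW _ w1U)).
have w1E : w1 = c *: w.
  have kw : n_killed (- c *: w + w1).
    by move=> z Nz; rewrite linearP /= w1k // n_killed_w // scaler0 addr0.
  apply/eqP; rewrite -subr_eq0 addrC -scaleNr; apply/eqP/hermdot_eq0.
  by rewrite hermdotPl cE // mulNr addNr.
have [c0|c0] := eqVneq c 0; [left | right].
  have orthU a : cyclic a -> forall a', a' \in U -> hermdot a a' = 0.
    elim=> {a} [|c' a a2 _ IH _ IH2|z a _ _ IH] a' a'U.
    - by have := w2U _ a'U; rewrite w1E c0 scale0r subr0.
    - by rewrite hermdotPl IH // IH2 // mulr0 addr0.
    - by rewrite hermdot_act_conj IH ?oppr0 //; apply: Usub.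
  apply/eqP; rewrite -subv0; apply/subvP => a aU; rewrite memv0;
    apply/eqP/hermdot_eq0/orthU => //.
  exact/WE/(subvP UW).
apply/eqP; rewrite eqEsubv UW; apply/subvP => a /WE.
elim=> {a} [|c' a a' _ aU _ a'U|z a _ _ aU].
- by rewrite -[w]scale1r -(mulVf c0) -scalerA -w1E rpredZ.
- by rewrite rpredD ?rpredZ.
- exact: Usub.
Qed.

End HighestWeight.

(** * Differentials of invariant polynomials *)

Lemma mpoly_ring_ind (A : comNzRingType) d (Q : mpoly d A -> Prop) :
  (forall a, Q (mpolyC d a)) -> (forall i, Q (mpolyX A (mnm1 i))) ->
  (forall p q, Q p -> Q q -> Q (p + q)) -> (forall p q, Q p -> Q q -> Q (p * q)) ->
  forall p, Q p.
Proof.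
move=> QC QX QD QM p; rewrite [p]mpolyE; elim/big_rec: _ => [|m q _ Qq].
  by rewrite -mpolyC0.
apply: QD Qq; rewrite -mul_mpolyC; apply: (QM) => //.
rewrite mpolyXE_id; elim/big_rec: _ => [|i q' _]; first by rewrite -mpolyC1.
apply: (QM); elim: (m i) => [|k IH]; first by rewrite expr0 -mpolyC1.
by rewrite exprS; apply: QM.
Qed.

Section ComplexCurves.
Context (R : realType).
Local Notation C := R[i].
Local Notation rc := (real_complex R).
Implicit Types (phi psi : R -> C).

Definition cderiv phi (l : C) :=
  is_derive (0 : R) (1 : R) (fun s => complex.Re (phi s) : R) (complex.Re l) /\
  is_derive (0 : R) (1 : R) (fun s => complex.Im (phi s) : R) (complex.Im l).

Lemma cderiv_cst c : cderiv (fun=> c) 0.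
Proof. by split; apply: is_derive_cst. Qed.

Lemma cderivD phi psi l l' :
  cderiv phi l -> cderiv psi l' -> cderiv (fun s => phi s + psi s) (l + l').
Proof.
move=> [r1 i1] [r2 i2]; split.
- rewrite (_ : (fun s => _) = fun s => complex.Re (phi s) + complex.Re (psi s)).
    apply: is_derive_eq (is_deriveD r1 r2) _; by case: l l' {r1 i1 r2 i2} => [? ?] [? ?].
  by apply/funext => s; case: (phi s) (psi s) => [? ?] [? ?].
- rewrite (_ : (fun s => _) = fun s => complex.Im (phi s) + complex.Im (psi s)).
    apply: is_derive_eq (is_deriveD i1 i2) _; by case: l l' {r1 i1 r2 i2} => [? ?] [? ?].
  by apply/funext => s; case: (phi s) (psi s) => [? ?] [? ?].
Qed.

Lemma cderivM phi psi l l' :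
  cderiv phi l -> cderiv psi l' ->
  cderiv (fun s => phi s * psi s) (l * psi 0 + phi 0 * l').
Proof.
move=> [r1 i1] [r2 i2]; split.
- rewrite (_ : (fun s => _) =
      fun s => complex.Re (phi s) * complex.Re (psi s) - complex.Im (phi s) * complex.Im (psi s)).
    have D1 := is_deriveM r1 r2; have D2 := is_deriveM i1 i2.
    apply: is_derive_eq (is_deriveB D1 D2) _.
    by case: (phi 0) (psi 0) l l' {r1 i1 r2 i2 D1 D2} => [? ?] [? ?] [? ?] [? ?] /=;
      rewrite /GRing.scale /=; ring.
  by apply/funext => s; case: (phi s) (psi s) => [? ?] [? ?].
- rewrite (_ : (fun s => _) =
      fun s => complex.Re (phi s) * complex.Im (psi s) + complex.Im (phi s) * complex.Re (psi s)).
    have D1 := is_deriveM r1 i2; have D2 := is_deriveM i1 r2.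
    apply: is_derive_eq (is_deriveD D1 D2) _.
    by case: (phi 0) (psi 0) l l' {r1 i1 r2 i2 D1 D2} => [? ?] [? ?] [? ?] [? ?] /=;
      rewrite /GRing.scale /=; ring.
  by apply/funext => s; case: (phi s) (psi s) => [? ?] [? ?].
Qed.

Lemma cderiv_eq phi l l' : cderiv phi l -> l = l' -> cderiv phi l'.
Proof. by move=> H <-. Qed.

Lemma cderiv_unique phi l l' : cderiv phi l -> cderiv phi l' -> l = l'.
Proof.
move=> [r1 i1] [r2 i2]; apply/eqP; rewrite eq_complex.
by rewrite -(derive_val (is_derive := r1)) -(derive_val (is_derive := i1)) !derive_val !eqxx.
Qed.

Lemma cderivZ c phi l : cderiv phi l -> cderiv (fun s => c * phi s) (c * l).
Proof.
by move=> dphi; apply: cderiv_eq (cderivM (cderiv_cst c) dphi) _; rewrite mul0r add0r.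
Qed.

Lemma cderiv_sum (I : Type) (r : seq I) (F : I -> R -> C) (l : I -> C) :
  (forall i, cderiv (F i) (l i)) ->
  cderiv (fun s => \sum_(i <- r) F i s) (\sum_(i <- r) l i).
Proof.
move=> dF; elim: r => [|i r IH].
  rewrite big_nil (_ : (fun s => _) = fun=> 0); first exact: cderiv_cst.
  by apply/funext => s; rewrite big_nil.
rewrite big_cons (_ : (fun s => _) = fun s => F i s + \sum_(j <- r) F j s).
  exact: cderivD.
by apply/funext => s; rewrite big_cons.
Qed.

Lemma cderiv_exp (a : R) : cderiv (fun s => rc (expR (s * a))) (rc a).
Proof.
split; last exact: is_derive_cst.
rewrite (_ : (fun s => _) = expR \o (fun s : R => s * a)) //.
apply: is_derive_eq (@is_derive1_comp R expR (fun s : R => s * a) 0 (expR (0 * a)) a _ _) _.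
  rewrite (_ : (fun s => _) = a \*: (id : R -> R)); last by apply/funext => s; rewrite /= mulrC.
  by apply: is_derive_eq (is_deriveZ a _) _; rewrite /GRing.scale /= mulr1.
by rewrite mul0r expR0 mul1r.
Qed.

Lemma cderiv_peval d (c : 'I_d -> R -> C) (c' : 'I_d -> C) (f : mpoly d C) :
  (forall j, cderiv (c j) (c' j)) ->
  cderiv (fun s => meval (fun j => c j s) f) (\sum_j meval (fun j => c j 0) (mderiv j f) * c' j).
Proof.
move=> dc; elim/mpoly_ring_ind: f => [a|i|p q dp dq|p q dp dq].
- apply: (@cderiv_eq _ 0).
    rewrite (_ : (fun s => _) = fun=> a); first exact: cderiv_cst.
    by apply/funext => s; rewrite mevalC.
  by rewrite big1 // => j _; rewrite mderivC meval0 mul0r.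
- rewrite (_ : (fun s => _) = c i); last by apply/funext => s; rewrite mevalXU.
  apply: cderiv_eq (dc i) _; rewrite (bigD1 i) //= big1 => [|j ji].
    rewrite mderivX mnm1E eqxx mevalZ mevalX big1 ?mulr1 ?mul1r ?addr0 // => j _.
    by rewrite mnmBE subnn expr0.
  by rewrite mderivX mnm1E eq_sym (negPf ji) scale0r meval0 mul0r.
- rewrite (_ : (fun s => _) = fun s => meval (fun j => c j s) p + meval (fun j => c j s) q).
    apply: cderiv_eq (cderivD dp dq) _; rewrite -big_split; apply: eq_bigr => j _ /=.
    by rewrite mderivD mevalD mulrDl.
  by apply/funext => s; rewrite mevalD.
- rewrite (_ : (fun s => _) = fun s => meval (fun j => c j s) p * meval (fun j => c j s) q).
    apply: cderiv_eq (cderivM dp dq) _; rewrite mulr_suml mulr_sumr -big_split;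
      apply: eq_bigr => j _ /=.
    by rewrite mderivM mevalD !mevalM mulrDl (mulrAC _ _ (c' j)) -(mulrA (meval _ p)).
  by apply/funext => s; rewrite mevalM.
Qed.

End ComplexCurves.

Lemma conj_diag_exp (F : fieldType) n (Q : 'M[F]_n) (D : 'rV_n) k : Q \in unitmx ->
  (invmx Q *m diag_mx D *m Q) ^+ k = invmx Q *m diag_mx (\row_j D 0 j ^+ k) *m Q.
Proof.
move=> Qu; elim: k => [|k IH].
  rewrite expr0 (_ : \row_j _ = const_mx 1) ?diag_const_mx ?mulmx1 ?mulVmx //.
  by apply/rowP => a; rewrite !mxE expr0.
rewrite exprS IH -[_ * _]/(_ *m _) !mulmxA mulmxK // -(mulmxA (invmx Q)) mulmx_diag.
by congr (_ *m diag_mx _ *m _); apply/rowP => a; rewrite !mxE exprS.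
Qed.

Lemma conj_diag_entry (F : fieldType) n k (B : 'M[F]_(k, n)) (D : 'rV_n) (Q : 'M_n) i j :
  (B *m diag_mx D *m Q) i j = \sum_a (B i a * Q a j) * D 0 a.
Proof. by rewrite mxE; apply: eq_bigr => a _; rewrite mul_mx_diag !mxE mulrAC. Qed.

Lemma scale_conj_diag (F : fieldType) n (c : F) (B Q : 'M[F]_n) (D : 'rV_n) :
  c *: (B *m diag_mx D *m Q) = B *m diag_mx (c *: D) *m Q.
Proof. by rewrite linearZ /= -scalemxAr -scalemxAl. Qed.

Section MatrixExponential.
Context (R : realType).
Local Notation C := R[i].
Local Notation rc := (real_complex R).
Local Open Scope classical_set_scope.

Lemma cvg_real_complex (u : nat -> R) (l : R) :
  u @ \oo --> l -> (fun N => rc (u N) : C^o) @ \oo --> (rc l : C^o).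
Proof.
move=> ul; apply/cvgrPdist_lt => eps eps0.
have eE : eps = rc (complex.Re eps) by rewrite (RRe_real (gtr0_real eps0)).
have e0 : 0 < complex.Re eps by rewrite -ltcR -eE.
have /cvgrPdist_lt/(_ _ e0) := ul; apply: filterS => N lt.
rewrite -rmorphB normc_def /= expr0n addr0 sqrtr_sqr eE ltcR //.
Qed.

Lemma is_expmx_diag n (Q : 'M[C]_n) (l : 'I_n -> R) : Q \in unitmx ->
  is_expmx (invmx Q *m diag_mx (\row_j rc (l j)) *m Q)
           (invmx Q *m diag_mx (\row_j rc (expR (l j))) *m Q).
Proof.
move=> Qu i j.
have entry (D : 'I_n -> C) : (invmx Q *m diag_mx (\row_j D j) *m Q) i j =
    \sum_a (invmx Q i a * Q a j) * D a.
  by rewrite conj_diag_entry; apply: eq_bigr => a _; rewrite mxE.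
rewrite entry.
have expE N : exp_sum (invmx Q *m diag_mx (\row_j rc (l j)) *m Q) N i j =
    \sum_a (invmx Q i a * Q a j) * rc (series (exp_coeff (l a)) N).
  rewrite /exp_sum summxE.
  transitivity (\sum_(k < N) \sum_a (invmx Q i a * Q a j) * rc (exp_coeff (l a) k)).
    apply: eq_bigr => k _; rewrite mxE conj_diag_exp // conj_diag_entry mulr_sumr.
    apply: eq_bigr => a _; rewrite mulrCA !mxE; congr (_ * _).
    by rewrite /exp_coeff /= rmorphM fmorphV rmorphXn rmorph_nat mulrC.
  rewrite exchange_big; apply: eq_bigr => a _.
  by rewrite -mulr_sumr /series /= big_mkord rmorph_sum.
rewrite (_ : (fun N => _) = fun N => \sum_a (invmx Q i a * Q a j) * rc (series (exp_coeff (l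
  a)) N) : C^o); last exact/funext.
elim: (index_enum _) => [|a s IH].
  rewrite big_nil (_ : (fun N => _) = fun=> 0); first exact: cvg_cst.
  by apply/funext => N; rewrite big_nil.
rewrite big_cons (_ : (fun N => _) =
  fun N => (invmx Q i a * Q a j) * rc (series (exp_coeff (l a)) N)
  + \sum_(b <- s) (invmx Q i b * Q b j) * rc (series (exp_coeff (l b)) N) : C^o).
  apply: cvgD IH; apply: cvgMl_tmp; apply: cvg_real_complex.
  exact: is_cvg_series_exp_coeff.
by apply/funext => N; rewrite big_cons.
Qed.

End MatrixExponential.

Lemma hermitian_diagonalization (R : realType) n (A : 'M[R[i]]_n) : A \is hermsymmx ->
  exists2 Q : 'M[R[i]]_n, Q \in unitmx
    & exists l : 'I_n -> R, A = invmx Q *m diag_mx (\row_j real_complex R (l j)) *m Q.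
Proof.
move=> Aherm; exists (spectralmx A); first exact: spectral_unit.
exists (fun j => complex.Re (spectral_diag A 0 j)).
have E : spectral_diag A = \row_j real_complex R (complex.Re (spectral_diag A 0 j)).
  apply/rowP => j; rewrite mxE RRe_real //.
  by have /mxOverP/(_ 0 j) := hermitian_spectral_diag_real Aherm.
by have /orthomx_spectralP := hermitian_normalmx Aherm; rewrite {1}E.
Qed.

Lemma differential_linear (R : realType) d (p : mpoly d R[i]) y :
  linear_for *%R (differential p y : 'rV[R[i]]_d -> R[i]).
Proof.
move=> c z z'; rewrite /differential mulr_sumr -big_split; apply: eq_bigr => j _ /=.
by rewrite !mxE mulrDr mulrCA.
Qed.

Lemma differentialZ (R : realType) d (p : mpoly d R[i]) y c (z : 'rV[R[i]]_d) :
  differential p y (c *: z) = c * differential p y z.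
Proof. by rewrite /differential mulr_sumr; apply: eq_bigr => j _; rewrite mxE mulrCA. Qed.

Section InvariantDifferential.
Context (R : realType) (g : lieAlgebra R) (theta : 'End(g)).
Context (m d : nat) (x : m.-tuple g) (e : d.-tuple g).
Hypothesis cartan_theta : cartan_involution theta.
Hypothesis x_orth : orthonormal_basis_k theta x.
Hypothesis e_orth : orthonormal_basis_p theta e.
Local Notation C := R[i].
Local Notation rc := (real_complex R).
Local Notation conjmx := (map_mx (@Num.conj C)).

(* For h real, - i ad h is Hermitian, hence diagonalizable with real eigenvalues, and
   only real exponentials are needed to differentiate f along its one-parameter group. *)
Lemma invariant_differential (f : mpoly d C) (y : 'rV[C]_d) (z : 'rV[C]_m) :
  Kc_invariant x e f -> differential f y (cact x e z y) = 0.
Proof.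
move=> finv.
have real_case (h : 'rV[C]_m) : conjmx h = h -> differential f y (cact x e h y) = 0.
  move=> hreal; pose z' := - 'i%C *: h; pose A := adc x e z'.
  have Aherm : A \is hermsymmx.
    apply/is_hermitianmxP; rewrite expr0 scale1r.
    have := adc_e_adjoint cartan_theta x_orth e_orth z'.
    rewrite map_mxZ hreal => ->.
    rewrite -linearN -scaleNr /A /z'; congr (adc _ _ (_ *: _)).
    by apply/eqP; rewrite eq_complex /= !oppr0 ?opprK !eqxx.
  have [Q Qu [l AE]] := hermitian_diagonalization Aherm.
  pose E s := invmx Q *m diag_mx (\row_j rc (expR (s * l j))) *m Q.
  have Eexp s : is_expmx (adc x e (rc s *: z')) (E s).
    have -> : adc x e (rc s *: z') = invmx Q *m diag_mx (\row_j rc (s * l j)) *m Q.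
      transitivity (rc s *: A); first exact: linearZ.
      have lE : rc s *: (\row_j rc (l j)) = \row_j rc (s * l j).
        by apply/rowP => j; rewrite !mxE rmorphM.
      by rewrite AE scale_conj_diag lE.
    exact: is_expmx_diag.
  have fE s : peval f (y *m E s) = peval f y.
    by rewrite -[E s]mulmx1; apply: finv; apply: AdKcM (Eexp s) (AdKc1 _ _).
  have E0 : y *m E 0 = y.
    rewrite /E (_ : \row_j _ = const_mx 1) ?diag_const_mx ?mulmx1 ?mulVmx ?mulmx1 //.
    by apply/rowP => j; rewrite !mxE mul0r expR0 rmorph1.
  have dE j : cderiv (fun s => (y *m E s) 0 j) ((y *m A) 0 j).
    have yE (D : 'I_d -> C) : (y *m (invmx Q *m diag_mx (\row_j D j) *m Q)) 0 j =
        \sum_a ((y *m invmx Q) 0 a * Q a j) * D a.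
      by rewrite !mulmxA conj_diag_entry; apply: eq_bigr => a _; congr (_ * _); rewrite mxE.
    have curveE : (fun s => (y *m E s) 0 j) =
        fun s => \sum_a ((y *m invmx Q) 0 a * Q a j) * rc (expR (s * l a)).
      by apply/funext => s; rewrite yE.
    rewrite curveE AE yE.
    by apply: cderiv_sum => a; apply: cderivZ; apply: cderiv_exp.
  have := cderiv_peval f dE.
  have -> : (fun s => meval (fun j => (y *m E s) 0 j) f) = fun=> peval f y.
    by apply/funext => s; apply: fE.
  move=> /cderiv_unique/(_ (cderiv_cst _)) D0.
  have {D0} : differential f y (y *m A) = 0.
    rewrite -[RHS]D0; apply: eq_bigr => j _; congr (_ * _).
    by rewrite /peval; apply: meval_eq => j'; rewrite E0.
  rewrite /A /z' linearZ /= -scalemxAr differentialZ => /eqP.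
  rewrite mulf_eq0 => /orP[|/eqP//].
  by rewrite oppr_eq0 eq_complex /= oner_eq0 andbF.
have cv y' : conjmx (cvec x y') = cvec x y' by apply/rowP => j; rewrite !mxE conj_rc.
have D1 := real_case _ (cv (re_k x z)); have D2 := real_case _ (cv (im_k x z)).
rewrite [z](re_imE x_orth) /cact addrC linearP /= mulmxDr -scalemxAr.
by rewrite differential_linear D1 D2 mulr0 addr0.
Qed.

End InvariantDifferential.

(** * Non-vanishing of Phi *)

Lemma horner_mmap (A : comNzRingType) d (h : 'I_d -> {poly A}) (p : mpoly d A) s :
  (mmap polyC h p).[s] = meval (fun j => (h j).[s]) p.
Proof.
rewrite mevalE /mmap horner_sum; apply: eq_bigr => mm _.
rewrite hornerM hornerC /mmap1 horner_prod; congr (_ * _).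
by apply: eq_bigr => i _; rewrite horner_exp.
Qed.

Section NonVanishing.
Context (R : realType) (g : lieAlgebra R) (theta : 'End(g)).
Context (m d r : nat) (x : m.-tuple g) (e : d.-tuple g).
Hypothesis cartan_theta : cartan_involution theta.
Hypothesis x_orth : orthonormal_basis_k theta x.
Hypothesis e_orth : orthonormal_basis_p theta e.
Local Notation C := R[i].
Local Notation rc := (real_complex R).
Local Notation tangent y := [seq y *m map_mx rc (ad_mx e xi) | xi <- x].

Lemma meval_Phic (a : ext C d) (y : 'rV[C]_d) :
  meval (fun j => y 0 j) (Phic x e a) = ext_dot (wedge (tangent y)) (hodge a).
Proof.
pose ev := (meval (fun j => y 0 j) \o map_mpoly rc : mpoly d R -> C).
pose evM : {rmorphism mpoly d R -> C} := ev.
have evC c : ev (mpolyC d c) = rc c by rewrite /ev /= map_mpolyC mevalC.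
have evPhi eta : ev (Phi x e eta) = \sum_S (wedge (tangent y) S : C) * rc (hodge eta S : R).
  rewrite /Phi /ext_dot -[ev _]/(evM _) rmorph_sum; apply: eq_bigr => S _ /=.
  rewrite !rmorphM ffunE /= map_mpolyC mevalC; congr (_ * _).
  have := congr1 (fun a : ext C d => a S) (ext_map_wedge evM
    [seq (\row_j mpolyX R (mnm1 j)) *m map_mx (@mpolyC d R) (ad_mx e xi) | xi <- x]).
  rewrite ffunE /= => ->; congr ((wedge _) S).
  rewrite -map_comp; apply: eq_map => xi /=.
  rewrite map_mxM; congr (_ *m _); apply/matrixP => i j; rewrite !mxE /=.
    by rewrite /ev /= map_mpolyX (mevalXU (fun j => y 0 j)) (ord1 i).
  exact: evC.
transitivity (ev (Phi x e (ext_map (@complex.Re R) a)) +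
  'i%C * ev (Phi x e (ext_map (@complex.Im R) a))).
  by rewrite /Phic mevalD mevalZ.
rewrite !evPhi mulr_sumr -big_split /=.
apply: eq_bigr => S _; rewrite mulrCA -mulrDr; congr (_ * _).
rewrite !ffunE !rmorphM rmorphXn rmorphN1 mulrCA -mulrDr; congr (_ * _).
exact/esym/complexE.
Qed.

Definition tangent_mx (y : 'rV[C]_d) : 'M[C]_(m, d) :=
  \matrix_(i < m) (y *m map_mx rc (ad_mx e (tnth x i))).

Lemma mul_tangent_mx z y : z *m tangent_mx y = cact x e z y.
Proof.
rewrite /cact /adc mulmx_sum_row mulmx_sumr; apply: eq_bigr => i _.
by rewrite rowK -scalemxAr.
Qed.

Lemma tangent_mx_linear : linear tangent_mx.
Proof.
move=> c y y'; apply/row_matrixP => i; rewrite linearP /= !rowK mulmxDl.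
by rewrite scalemxAl.
Qed.

Lemma tangent_mx_regular y0 : y0 \in ppart theta ->
  (forall c, c \in kpart theta -> bracket c y0 = 0 -> c = 0) ->
  row_free (tangent_mx (\row_j rc (coord e j y0))).
Proof.
move=> y0p y0reg; have [[eb _]] := e_orth.
set y := \row_j _.
have cE c j : c \in kpart theta -> cact x e (cvec x c) y 0 j = rc (coord e j (bracket c y0)).
  move=> ck; rewrite /cact (adc_cvec x_orth) // [in RHS](coord_basis eb y0p) !linear_sum
    raddf_sum mxE.
  by apply: eq_bigr => i _; rewrite !mxE linearZ /= linearZ rmorphM -tnth_nth.
rewrite -kermx_eq0 -submx0; apply/row_subP => i.
have := row_sub i (kermx (tangent_mx y)); set z := row i _ => /sub_kermxP.
rewrite mul_tangent_mx => /rowP zy.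
have k1 : re_k x z \in kpart theta by apply: sum_xk.
have k2 : im_k x z \in kpart theta by apply: sum_xk.
have {}zy j : coord e j (bracket (re_k x z) y0) = 0 /\ coord e j (bracket (im_k x z) y0) = 0.
  have := zy j; rewrite {1}[z](re_imE x_orth) /cact linearD linearZ /= mulmxDr -scalemxAr mxE
    [X in _ + X]mxE.
  by rewrite -![y *m adc _ _ _]/(cact _ _ _ _) !cE // mxE; simpc; case=> -> ->.
have coord0 c : c \in kpart theta -> (forall j, coord e j (bracket c y0) = 0) -> c = 0.
  move=> ck c0; apply: y0reg => //.
  by rewrite (coord_basis eb (bracket_kp cartan_theta ck y0p)) big1 // => j _; rewrite c0 scale0r.
have re0 : re_k x z = 0 by apply: coord0 => // j; case: (zy j).
have im0 : im_k x z = 0 by apply: coord0 => // j; case: (zy j).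
rewrite [z](re_imE x_orth) re0 im0.
rewrite (_ : cvec x 0 = 0) ?scaler0 ?addr0 ?sub0mx //.
by apply/rowP => j; rewrite !mxE linear0 rmorph0.
Qed.

Context (f : r.-tuple (mpoly d C)) (v : {vspace 'rV[C]_d}) (u : r.-tuple 'rV[C]_d).
Hypothesis f_inv : forall i, Kc_invariant x e (tnth f i).
Hypothesis u_basis : basis_of v u.
Hypothesis dim_d : d = (r + m)%N.

Definition differential_mx (y : 'rV[C]_d) : 'M[C]_r :=
  \matrix_(i, j) differential (tnth f i) y (tnth u j).

Lemma differential_sum p y n (E : 'I_n -> 'rV[C]_d) (c : 'I_n -> C) :
  differential p y (\sum_i c i *: E i) = \sum_i c i * differential p y (E i).
Proof.
elim/big_ind2: _ => [|c1 z c2 z' <- <-|i _]; last exact: differentialZ.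
  by rewrite -[0 in LHS](scale0r 0) differentialZ mul0r.
by rewrite -[z]scale1r differential_linear mul1r scale1r.
Qed.

Lemma differential_mx_unit y : differentials_independent f v y -> \det (differential_mx y) != 0.
Proof.
move=> indep; rewrite -unitfE -[_ \is a _]unitmxE -row_free_unit -kermx_eq0 -submx0.
apply/row_subP => i; have := row_sub i (kermx (differential_mx y)); set c := row i _.
move=> /sub_kermxP/rowP cG; rewrite (_ : c = 0) ?sub0mx //; apply/rowP => l; rewrite [RHS]mxE.
apply: (indep (fun l => c 0 l)) => z zv; rewrite (coord_basis u_basis zv).
under eq_bigr => k _ do rewrite differential_sum mulr_sumr.
rewrite exchange_big big1 // => j _ /=.
have := cG j; rewrite mxE [RHS]mxE => cGj; transitivity (coord u j z * 0); last by rewrite mulr0.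
rewrite -{2}cGj mulr_sumr; apply: eq_bigr => k _.
by rewrite [differential_mx _ _ _]mxE mulrCA (tnth_nth 0 u).
Qed.

Lemma common_regular_point y1 y0 : \det (differential_mx y1) != 0 -> row_free (tangent_mx y0) ->
  exists y, \det (differential_mx y) != 0 /\ row_free (tangent_mx y).
Proof.
move=> d1 /row_freeP[N TN].
pose yX (j : 'I_d) : {poly C} := (y1 0 j)%:P + (y0 0 j - y1 0 j) *: 'X.
pose ys s := y1 + s *: (y0 - y1).
have yXE s j : (yX j).[s] = ys s 0 j by rewrite !mxE hornerD hornerC hornerZ hornerX mulrC.
pose GX : 'M[{poly C}]_r := \matrix_(i, j)
  \sum_k mmap polyC yX (mderiv k (tnth f i)) * (tnth u j 0 k)%:P.
have GE s : (\det GX).[s] = \det (differential_mx (ys s)).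
  rewrite -[_.[s]]/(horner_eval s _) -det_map_mx; congr (\det _).
  apply/matrixP => i j; rewrite [LHS]mxE [GX i j]mxE [RHS]mxE -[LHS]/(horner _ s) horner_sum;
    apply: eq_bigr => k _.
  rewrite hornerM hornerC horner_mmap; congr (_ * _).
  by apply: meval_eq => l; rewrite yXE.
pose TX : 'M[{poly C}]_m := map_mx polyC (tangent_mx y1 *m N) +
  'X *: map_mx polyC (tangent_mx (y0 - y1) *m N).
have TE s : (\det TX).[s] = \det (tangent_mx (ys s) *m N).
  by rewrite horner_det_line /ys [in RHS]addrC tangent_mx_linear addrC mulmxDl scalemxAl.
have G0 : \det GX != 0.
  by apply: contraNneq d1 => G0; have := GE 0; rewrite G0 horner0 /ys scale0r addr0 => <-.
have T0 : \det TX != 0.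
  apply/eqP => T0; have := TE 1; rewrite T0 horner0 /ys scale1r addrC subrK TN det1.
  by move/esym/eqP; rewrite oner_eq0.
have [n] := poly_nonroot (mulf_neq0 G0 T0).
rewrite hornerM mulf_eq0 negb_or GE TE => /andP[Gn Tn]; exists (ys n%:R); split=> //.
apply/row_freeP; exists (N *m invmx (tangent_mx (ys n%:R) *m N)).
by rewrite mulmxA mulmxV // unitmxE unitfE.
Qed.

Lemma Phic_neq0 y : \det (differential_mx y) != 0 -> row_free (tangent_mx y) ->
  Phic x e (wedge u) != 0.
Proof.
move=> Gy Ty; apply/eqP => Phi0.
have := meval_Phic (wedge u) y; rewrite Phi0 meval0 ext_dot_hodge -wedge_cat => /esym/eqP.
apply/negP; apply: wedge_neq0_top; last by rewrite size_cat size_map !size_tuple.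
pose T : m.-tuple 'rV[C]_d := [tuple of tangent y].
have TE (c : 'I_m -> C) : \sum_i c i *: T`_i = cact x e (\row_i c i) y.
  rewrite -mul_tangent_mx mulmx_sum_row; apply: eq_bigr => i _.
  by rewrite mxE rowK -tnth_nth tnth_map.
rewrite cat_free (basis_free u_basis) /=; apply/andP; split.
  apply/(freeP (X := T)) => c; rewrite TE -mul_tangent_mx => /eqP.
  by rewrite mulmx_free_eq0 // => /eqP/rowP c0 i; have := c0 i; rewrite !mxE.
apply/directv_addP/eqP; rewrite -subv0; apply/subvP => z; rewrite memv_cap memv0 => /andP[zu zT].
have fz i : differential (tnth f i) y z = 0.
  rewrite -[tangent y]/(tval T) in zT; rewrite (coord_span zT) TE.
  exact: (invariant_differential cartan_theta x_orth e_orth).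
have zE := coord_span zu.
have : differential_mx y *m \col_j coord u j z = 0.
  apply/matrixP => i j; rewrite mxE [RHS]mxE -[RHS](fz i) zE differential_sum.
  by apply: eq_bigr => k _; rewrite !mxE -tnth_nth mulrC -zE.
move=> /(congr1 (mulmx (invmx (differential_mx y)))); rewrite mulmx0 mulKmx ?unitmxE ?unitfE //.
move=> /colP c0; rewrite zE big1 // => j _.
by have := c0 j; rewrite !mxE => ->; rewrite scale0r.
Qed.

End NonVanishing.

Lemma generators_invariant (R : realType) (g : lieAlgebra R) m d r (x : m.-tuple g)
    (e : d.-tuple g) (f : r.-tuple (mpoly d R[i])) :
  free_homogeneous_generators x e f -> forall i, Kc_invariant x e (tnth f i).
Proof.
move=> [_ _ finv] i; apply/finv; exists (mpolyX _ (mnm1 i)).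
by rewrite comp_mpolyXU (tnth_nth 0).
Qed.

Theorem theorem5 (R : realType) (g : lieAlgebra R) (theta : 'End(g))
    (m d r : nat) (x : m.-tuple g) (e : d.-tuple g)
    (f : r.-tuple (mpoly d R[i]))
    (t : {vspace g}) (P : {scalar 'rV[R[i]]_m} -> Prop)
    (b : {vspace 'rV[R[i]]_m}) (v : {vspace 'rV[R[i]]_d})
    (u : r.-tuple 'rV[R[i]]_d) :
  noncompact_type theta ->
  maximal_rank theta ->
  symmetric_rank theta r ->
  orthonormal_basis_k theta x ->
  orthonormal_basis_p theta e ->
  free_homogeneous_generators x e f ->
  maximal_abelian_in (kpart theta) t ->
  positive_system x t P ->
  borel_subalgebra x t P b ->
  \dim v = r ->
  stable_under x e b v ->
  (exists y : 'rV[R[i]]_d, differentials_independent f v y) ->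
  basis_of v u ->
  highest_weight_vector x e t P (wedge u) /\
  exists W : {vspace ext R[i] d},
    [/\ irreducible_component x e r W, wedge u \in W
      & exists2 a, a \in W & Phic x e a != 0].
Proof.
move=> [cartan_theta _] [n [rank_n lie_n]] rank_r x_orth e_orth f_gen t_max P_pos b_borel _.
move=> v_stable [y1 y1_indep] u_basis.
split; first exact: (wedge_highest_weight cartan_theta x_orth e_orth P_pos b_borel v_stable).
have [W Wirr wW] := cyclic_irreducible cartan_theta x_orth e_orth t_max P_pos b_borel v_stable
  u_basis.
exists W; split=> //; exists (wedge u) => //.
have [[a a_max] dim_r] := rank_r.
have lie_r : lie_rank g r by rewrite -(dim_r a a_max) (rank_n.2 a a_max).
have [y0 y0a y0reg] := regular_element cartan_theta a_max (dim_r a a_max) lie_r.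
have [ap _ _] := a_max.
have y0T := tangent_mx_regular cartan_theta x_orth e_orth (subvP ap _ y0a) y0reg.
have dim_d : d = (r + m)%N.
  have := dim_kp cartan_theta a_max (dim_r a a_max) lie_r.
  have [[xb _] [eb _]] := (x_orth, e_orth).
  by rewrite (vector.size_basis xb) (vector.size_basis eb) addnC => <-.
have [y [Gy Ty]] := common_regular_point (differential_mx_unit u_basis y1_indep) y0T.
exact: (Phic_neq0 cartan_theta x_orth e_orth (generators_invariant f_gen) u_basis dim_d Gy Ty).
Qed.
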